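(* Let $G$ be a finite group, $\omega\in Z^3(G,\mathbb{C}^\times)$ a (normalized) 3-cocycle, and $\mathbf{V}=(V,X,(V_x)_{x\in X})$ a monomial Yetter-Drinfeld module in $\mathcal{Z}(\operatorname{Vec}_G^\omega)$, with fixed non-zero vectors $v_x\in V_x$ for $x\in X$. Let $Y$ be the set of all regular elements in $(X^n)_e=\{(x_1,\ldots,x_n)\in X^n:|x_1|\cdots|x_n|=e\}$ and $R\subset Y$ a set of representatives of the $G$-orbits of $Y$. (a) The projection $\pi:Y\to R$ (sending an element to the representative of its $G$-orbit) is a map of $\mathcal{B}_n$-sets. The image of $\mathbf{x}\in R$ by the generator $\sigma_i\in\mathcal{B}_n$ will be denoted by $\sigma_i\triangleright\mathbf{x}$. (b) For $\mathbf{x}=(x_1,\ldots,x_n)\in R$ put $v_{\mathbf{x}}=v_{x_1}\otimes\cdots\otimes v_{x_n}$. The action of the generator $\sigma_i\in\mathcal{B}_n$ on $\operatorname{Hom}_{\mathcal{Z}(\operatorname{Vec}_G^\omega)}(\mathbb{C},V^{\otimes n})=((V^{\otimes n})_e)^G$ in the basis $\{\operatorname{Av}_G(v_{\mathbf{x}}):\mathbf{x}\in R\}$ is given by $$\sigma_i(\operatorname{Av}_G(v_{\mathbf{x}}))=\beta_{i,\mathbf{x}}\operatorname{Av}_G(v_{\sigma_i\triangleright\mathbf{x}}),$$ where $$\beta_{i,\mathbf{x}}=\omega^{-1}(|x_1|\cdots|x_{i-1}|,\,|x_{i+1}|,\,|x_i|)\,\lambda_X(|x_i|;x_{i+1})\,\omega(|x_1|\cdots|x_{i-1}|,|x_i|,|x_{i+1}|)\,\lambda_{X^n}(g_{\mathbf{x}};\sigma_i'(\mathbf{x})),$$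 $\sigma_i'(\mathbf{x})=(x_1,\ldots,x_{i-1},|x_i|x_{i+1},x_i,x_{i+2},\ldots,x_n)$, and $g_{\mathbf{x}}\in G$ is a chosen element with $g_{\mathbf{x}}\,\sigma_i'(\mathbf{x})\in R$.
   Context: Monomial spaces. A monomial space is a triple $(V,X,(V_x)_{x\in X})$ with $V$ a finite dimensional complex vector space, $X$ a finite set, and $V_x\subseteq V$ one-dimensional subspaces with $V=\bigoplus_{x\in X}V_x$. A monomial representation of a group on it is a linear representation on $V$ such that each group element permutes the $V_x$; then the group acts on $X$. An element $x\in X$ is regular if every element of its stabilizer acts as the identity on $V_x$. For a representation of the finite group $G$, $\operatorname{Av}_G(v)=\frac1{|G|}\sum_{g\in G}g\triangleright v$, and a superscript $G$ denotes the subspace of invariant vectors. The category $\mathcal{Z}(\operatorname{Vec}_G^\omega)$. Let $e$ be the identity of $G$ and ${}^gh=ghg^{-1}$. A normalized 3-cocycle is a map $\omega:G\times G\times G\to\mathbb{C}^\times$ with $\omega(ab,c,d)\,\omega(a,b,cd)=\omega(a,b,c)\,\omega(a,bc,d)\,\omega(b,c,d)$ and $\omega(a,e,b)=1$. Put $$\omega(g,g';h)=\frac{\omega(g,{}^{g'}h,g')}{\omega({}^{gg'}h,g,g')\,\omega(g,g',h)},\qquad \omega(g;f,h)=\omega(g,f,h)\,\omega({}^gf,g,h)^{-1}\,\omega({}^gf,{}^gh,g).$$ Objects are $G$-graded vector spaces $V=\bigoplus_{g\in G}V_g$ with linear maps $v\mapsto g\triangleright v$ ($g\in G$), the twisted $G$-action,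 such that $e\triangleright v=v$, $(gh)\triangleright v=\omega(g,h;k)\,(g\triangleright(h\triangleright v))$ for $v\in V_k$, and $g\triangleright V_h\subseteq V_{ghg^{-1}}$. Morphisms are linear maps preserving the grading and commuting with the twisted action. The tensor product is the usual tensor product with $(V\otimes W)_g=\bigoplus_{h}V_h\otimes W_{h^{-1}g}$ and $h\triangleright(v\otimes w)=\omega(h;g,l)\,(h\triangleright v)\otimes(h\triangleright w)$ for $v\in V_g,w\in W_l$. The associativity constraint is $a_{V,W,Z}((v\otimes w)\otimes z)=\omega(g,h,k)\,v\otimes(w\otimes z)$ for $v\in V_g,w\in W_h,z\in Z_k$, the unit object is $\mathbb{C}$, and the braiding is $c_{V,W}(v\otimes w)=(g\triangleright w)\otimes v$ for $v\in V_g$. Braid group action. $V^{\otimes n}$ is parenthesized from the left: $(\cdots(V\otimes V)\otimes\cdots)\otimes V$. The generator $\sigma_i\in\mathcal{B}_n$ of the braid group acts on $V^{\otimes n}$ by $$\sigma_i'=(a^{-1}_{V^{\otimes(i-1)},V,V}\otimes\operatorname{id})\circ(\operatorname{id}_{V^{\otimes(i-1)}}\otimes c_{V,V}\otimes\operatorname{id})\circ(a_{V^{\otimes(i-1)},V,V}\otimes\operatorname{id}),$$ where the last $\operatorname{id}$ in each factor is on the remaining $n-i-1$ tensor factors; $\mathcal{B}_n$ acts on $\operatorname{Hom}(\mathbb{C},V^{\otimes n})=((V^{\otimes n})_e)^G$ by restriction of these automorphisms. Monomial Yetter-Drinfeld modules. A monomial Yetter-Drinfeld module is a monomial space $(V,X,(V_x)_{x\in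 X})$ with $V\in\mathcal{Z}(\operatorname{Vec}_G^\omega)$ such that the twisted $G$-action permutes the $V_x$'s and each $V_x$ is $G$-homogeneous. Then $G$ acts on $X$ (written $gx$), $|x|\in G$ denotes the degree of $V_x$, and $|gx|=g|x|g^{-1}$. The group $\mathcal{B}_n$ acts on $X^n$ by letting $\sigma_i$ act as $\sigma_i'(x_1,\ldots,x_n)=(x_1,\ldots,x_{i-1},|x_i|x_{i+1},x_i,x_{i+2},\ldots,x_n)$; $G$ acts diagonally on $X^n$. The action of $G$ on the degree-$e$ part $(V^{\otimes n})_e=\bigoplus_{(x_1,\ldots,x_n)\in(X^n)_e}V_{x_1}\otimes\cdots\otimes V_{x_n}$ is a monomial representation; regularity of elements of $(X^n)_e$ refers to it. Scalars. $\lambda_X:G\times X\to\mathbb{C}^\times$ is defined by $g\triangleright v_x=\lambda_X(g;x)v_{gx}$, and $$\lambda_{X^n}(g;x_1,\ldots,x_n)=\Big(\prod_{i=1}^n\lambda_X(g;x_i)\Big)\prod_{j=2}^{n}\omega(g;|x_1|\cdots|x_{j-1}|,|x_j|),$$ so that $g\triangleright(v_{x_1}\otimes\cdots\otimes v_{x_n})=\lambda_{X^n}(g;x_1,\ldots,x_n)\,v_{gx_1}\otimes\cdots\otimes v_{gx_n}$. Empty products in $G$ are $e$.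
   Formalization: The scalars ω(g,g';h) and ω(g;f,h) are replaced by their inverses (as displayed, the associator need not commute with the twisted G-action), and the first factor of β is corrected to ω^{-1}(|x_1|⋯|x_{i-1}|, |x_i||x_{i+1}||x_i|^{-1}, |x_i|). *)

(* Defs.v *)
From HB Require Import structures.
From mathcomp Require Import all_boot all_order all_fingroup all_algebra.
From mathcomp Require Import boolp.

Set Implicit Arguments.
Unset Strict Implicit.
Unset Printing Implicit Defensive.

Import GRing.Theory.
Local Open Scope ring_scope.

(** * The braid group, by Artin's presentation

   The generator sigma_k (1 <= k <= n - 1) is the index k - 1 : 'I_n.-1.
   A word is a sequence of letters (i, b), standing for sigma_{i+1} if b = true
   and for its inverse if b = false. *)

Definition braid_word (n : nat) := seq ('I_n.-1 * bool).

Inductive braid_rel (n : nat) : braid_word n -> braid_word n -> Prop :=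
| braid_rel_refl u : braid_rel u u
| braid_rel_sym u v : braid_rel u v -> braid_rel v u
| braid_rel_trans u v w : braid_rel u v -> braid_rel v w -> braid_rel u w
| braid_rel_cat u u' v v' :
    braid_rel u u' -> braid_rel v v' -> braid_rel (u ++ v) (u' ++ v')
| braid_rel_inv i b : braid_rel [:: (i, b); (i, ~~ b)] [::]
| braid_rel_far (i j : 'I_n.-1) : (i.+1 < j)%N ->
    braid_rel [:: (i, true); (j, true)] [:: (j, true); (i, true)]
| braid_rel_near (i j : 'I_n.-1) : i.+1 = j :> nat ->
    braid_rel [:: (i, true); (j, true); (i, true)]
              [:: (j, true); (i, true); (j, true)].

Section BraidGroup.
Variable n : nat.
Implicit Types u v w : braid_word n.

Definition braid_relb u v : bool := `[< braid_rel u v >].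

Lemma braid_relb_refl : reflexive braid_relb.
Proof. by move=> u; apply/asboolP/braid_rel_refl. Qed.

Lemma braid_relb_sym : symmetric braid_relb.
Proof. by move=> u v; apply/asboolP/asboolP => /braid_rel_sym. Qed.

Lemma braid_relb_trans : transitive braid_relb.
Proof.
move=> v u w /asboolP uv /asboolP vw; apply/asboolP; exact: braid_rel_trans vw.
Qed.

Canonical braid_equiv :=
  EquivRel braid_relb braid_relb_refl braid_relb_sym braid_relb_trans.

Definition braid : Type := {eq_quot braid_equiv}%qT.
HB.instance Definition _ := Choice.on braid.

Definition braid_of_word u : braid := (\pi_({eq_quot braid_equiv}) u)%qT.

Definition braid_repr (x : braid) : braid_word n :=
  @generic_quotient.repr _ {eq_quot braid_equiv}%qT x.

Lemma braid_of_wordP u v : braid_of_word u = braid_of_word v <-> braid_rel u v.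
Proof.
split=> [e|h].
  by have /eqP := e; rewrite /braid_of_word eqmodE => /asboolP.
by apply/eqP; rewrite /braid_of_word eqmodE; apply/asboolP.
Qed.

Definition braid_word_inv u : braid_word n := rev [seq (a.1, ~~ a.2) | a <- u].

Definition braid_one : braid := braid_of_word [::].
Definition braid_mul (x y : braid) : braid :=
  braid_of_word (braid_repr x ++ braid_repr y).
Definition braid_inv (x : braid) : braid := braid_of_word (braid_word_inv (braid_repr x)).

Lemma repr_braidK (x : braid) : braid_of_word (braid_repr x) = x.
Proof. exact: generic_quotient.reprK. Qed.

Lemma repr_braid u : braid_rel (braid_repr (braid_of_word u)) u.
Proof. by apply/braid_of_wordP; rewrite repr_braidK. Qed.

Lemma braid_mul_word u v :
  braid_mul (braid_of_word u) (braid_of_word v) = braid_of_word (u ++ v).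
Proof. by apply/braid_of_wordP/braid_rel_cat; apply: repr_braid. Qed.

Lemma braid_rel_invl u : braid_rel (braid_word_inv u ++ u) [::].
Proof.
elim: u => [|[i b] u IHu]; first exact: braid_rel_refl.
rewrite /braid_word_inv /= rev_cons cat_rcons.
apply: braid_rel_trans IHu; apply: braid_rel_cat; first exact: braid_rel_refl.
rewrite -[X in braid_rel _ X]cat0s -(cat1s (i, b)) -cat1s catA.
apply: braid_rel_cat; last exact: braid_rel_refl.
by rewrite /= -{2}[b]negbK; apply: braid_rel_inv.
Qed.

Lemma braid_word_invK : involutive braid_word_inv.
Proof.
move=> u; rewrite /braid_word_inv map_rev revK -map_comp -[RHS]map_id.
by apply: eq_map => -[i b] /=; rewrite negbK.
Qed.

Lemma braid_mulA : associative braid_mul.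
Proof.
move=> x y z; rewrite -(repr_braidK x) -(repr_braidK y) -(repr_braidK z).
by rewrite !braid_mul_word catA.
Qed.

Lemma braid_mul1 : left_id braid_one braid_mul.
Proof. by move=> x; rewrite -(repr_braidK x) braid_mul_word cat0s. Qed.

Lemma braid_mulr1 : right_id braid_one braid_mul.
Proof. by move=> x; rewrite -(repr_braidK x) braid_mul_word cats0. Qed.

Lemma braid_mulV : left_inverse braid_one braid_inv braid_mul.
Proof.
move=> x; rewrite /braid_inv -{2}(repr_braidK x) braid_mul_word.
exact/braid_of_wordP/braid_rel_invl.
Qed.

Lemma braid_mulrV : right_inverse braid_one braid_inv braid_mul.
Proof.
move=> x; rewrite /braid_inv -{1}(repr_braidK x) braid_mul_word.
apply/braid_of_wordP; rewrite -{1}(braid_word_invK (braid_repr x)).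
exact: braid_rel_invl.
Qed.

HB.instance Definition _ := isGroup.Build braid
  braid_mulA braid_mul1 braid_mulr1 braid_mulV braid_mulrV.

Definition braid_gen (i : 'I_n.-1) : braid := braid_of_word [:: (i, true)].

Definition braid_action (T : finType) (S : {set T}) (a : braid -> T -> T) :=
  [/\ {in S, forall x b, a b x \in S},
      {in S, forall x, a 1%g x = x}
    & {in S, forall x b c, a (b * c)%g x = a b (a c x)}].

End BraidGroup.

(** * Tensor products of finite dimensional vector spaces *)

Section Tensor.
Variable K : fieldType.
Implicit Types U V W : vectType K.

(* Coordinates with respect to the basis [vbasis fullv] represent U (x) V by
   matrices; tlift_tens and tens_hom_ext are the universal property. *)
Definition tensor U V : vectType K := 'M[K]_(\dim {:U}, \dim {:V}).

Definition tens U V (u : U) (v : V) : tensor U V :=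
  \matrix_(i, j) (coord (vbasis {:U}) i u * coord (vbasis {:V}) j v).

(* The linear map u (x) v |-> f u v, for f bilinear. *)
Definition tlift U V W (f : U -> V -> W) : 'Hom(tensor U V, W) :=
  linfun (fun M : tensor U V =>
    \sum_i \sum_j (M : 'M[K]_(\dim {:U}, \dim {:V})) i j *: f (vbasis {:U})`_i (vbasis {:V})`_j).

Definition tmap U V U' V' (f : 'Hom(U, U')) (g : 'Hom(V, V')) :
  'Hom(tensor U V, tensor U' V') := tlift (fun u v => tens (f u) (g v)).

(* The subspace A (x) B of U (x) V. *)
Definition tensv U V (A : {vspace U}) (B : {vspace V}) :
  {vspace tensor U V} :=
  <<[seq tens a b | a <- (vbasis A : seq U), b <- (vbasis B : seq V)]>>%VS.

Lemma tlift_linear U V W (f : U -> V -> W) :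
  linear (fun M : tensor U V =>
    \sum_i \sum_j (M : 'M[K]_(\dim {:U}, \dim {:V})) i j *: f (vbasis {:U})`_i (vbasis {:V})`_j).
Proof.
move=> a M N /=; rewrite scaler_sumr -big_split; apply: eq_bigr => i _ /=.
rewrite scaler_sumr -big_split; apply: eq_bigr => j _ /=.
by rewrite !mxE scalerDl scalerA.
Qed.

Lemma tliftE U V W (f : U -> V -> W) (M : tensor U V) :
  tlift f M =
  \sum_i \sum_j (M : 'M[K]_(\dim {:U}, \dim {:V})) i j *: f (vbasis {:U})`_i (vbasis {:V})`_j.
Proof.
pose F := GRing.isLinear.Build K (tensor U V) W *:%R _ (tlift_linear f).
pose FL := HB.pack_for {linear tensor U V -> W} (fun M : tensor U V =>
    \sum_i \sum_j (M : 'M[K]_(\dim {:U}, \dim {:V})) i j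
      *: f (vbasis {:U})`_i (vbasis {:V})`_j) F.
exact: (lfunE FL).
Qed.

Lemma tlift_tens U V W (f : U -> V -> W) :
    (forall v, linear (f^~ v)) -> (forall u, linear (f u)) ->
  forall u v, tlift f (tens u v) = f u v.
Proof.
move=> fl fr u v.
have sumf (A B : vectType K) (g : A -> B) : linear g ->
    forall I (r : seq I) (c : I -> K) (e : I -> A),
    g (\sum_(i <- r) c i *: e i) = \sum_(i <- r) c i *: g (e i).
  move=> lg I r c e; pose F := GRing.isLinear.Build K A B *:%R _ lg.
  pose G := HB.pack_for {linear A -> B} g F.
  rewrite -[LHS]/(G _) linear_sum; apply: eq_bigr => i _.
  by rewrite linearZ.
rewrite tliftE [in RHS](coord_vbasis (memvf u)) [in RHS](coord_vbasis (memvf v)).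
rewrite (sumf _ _ _ (fl _)); apply: eq_bigr => i _.
rewrite (sumf _ _ _ (fr _)) scaler_sumr; apply: eq_bigr => j _.
by rewrite scalerA mxE.
Qed.

Lemma tens_hom_ext U V W (f g : 'Hom(tensor U V, W)) :
  (forall u v, f (tens u v) = g (tens u v)) -> f = g.
Proof.
move=> fg; apply/lfunP => M.
have -> : M = \sum_i \sum_j (M : 'M[K]_(\dim {:U}, \dim {:V})) i j
                *: tens (vbasis {:U})`_i (vbasis {:V})`_j.
  rewrite [LHS](matrix_sum_delta (M : 'M[K]_(\dim {:U}, \dim {:V}))).
  apply: eq_bigr => i _; apply: eq_bigr => j _.
  congr (_ *: _); apply/matrixP => k l; rewrite !mxE.
  rewrite !coord_free ?(basis_free (vbasisP _)) //.
  rewrite (eq_sym k) (eq_sym l); do 2!case: eqP => _; by rewrite ?mulr1 ?mulr0.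
rewrite !linear_sum; apply: eq_bigr => i _; rewrite !linear_sum.
by apply: eq_bigr => j _; rewrite !linearZ /= fg.
Qed.

End Tensor.

(** * The category Z(Vec_G^omega) *)

Record cocycle3 (K : fieldType) (gT : finGroupType) := Cocycle3 {
  cocycle :> gT -> gT -> gT -> K;
  cocycle_neq0 : forall a b c, cocycle a b c != 0;
  cocycleM : forall a b c d,
    cocycle (a * b)%g c d * cocycle a b (c * d)%g =
    cocycle a b c * cocycle a (b * c)%g d * cocycle b c d;
  cocycle1 : forall a b, cocycle a 1%g b = 1 }.

Definition lconj (gT : finGroupType) (g h : gT) : gT := (g * h * g^-1)%g.

(* The data underlying an object; the axioms are in [is_center_object]. *)
Record gspace (K : fieldType) (gT : finGroupType) := GSpace {
  gcar :> vectType K;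
  homog : gT -> {vspace gcar};
  gact : gT -> 'End(gcar) }.

Section Center.
Variables (K : fieldType) (gT : finGroupType) (omega : cocycle3 K gT).
Implicit Types (A B C : gspace K gT) (g h k l : gT).

(* omega2 g g' h is omega(g,g';h) and omega1 g f h is omega(g;f,h). Since the
   associator below is given by omega, and not by its inverse as in the
   conventions of Dijkgraaf-Pasquier-Roche, these are the inverses of their
   theta and gamma: only then are the associator and the braiding morphisms
   commuting with the twisted action. *)
Definition omega2 g g' h : K :=
  omega (lconj (g * g')%g h) g g' * omega g g' h / omega g (lconj g' h) g'.

Definition omega1 g f h : K :=
  omega (lconj g f) g h / (omega g f h * omega (lconj g f) (lconj g h) g).

Definition is_center_object A :=
  [/\ directv (\sum_g homog A g)%VS,
      (\sum_g homog A g)%VS = fullv,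
      forall u, gact A 1%g u = u,
      forall g h k, {in homog A k, forall u,
        gact A (g * h)%g u = omega2 g h k *: gact A g (gact A h u)}
    & forall g h, (gact A g @: homog A h <= homog A (lconj g h))%VS].

(* Projection to the component of degree g of the grading. *)
Definition gproj A g : 'End(A) := linfun (sumv_pi (\sum_g homog A g)%VS g).

Definition center_unit : gspace K gT :=
  @GSpace K gT K^o (fun g => if g == 1%g then fullv else 0%VS) (fun _ => \1%VF).

Definition center_tensor A B : gspace K gT :=
  @GSpace K gT (tensor A B)
    (fun g => \sum_h tensv (homog A h) (homog B (h^-1 * g)%g))%VS
    (fun h => tlift (fun u v => \sum_g \sum_l
       omega1 h g l *: tens (gact A h (gproj A g u)) (gact B h (gproj B l v)))).

Definition center_assoc A B C :
    'Hom(center_tensor (center_tensor A B) C,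
         center_tensor A (center_tensor B C)) :=
  tlift (fun (p : tensor A B) w => tlift (fun u v => \sum_g \sum_h \sum_k
    omega g h k *: tens (gproj A g u) (tens (gproj B h v) (gproj C k w))) p).

Definition center_braiding A B : 'Hom(center_tensor A B, center_tensor B A) :=
  tlift (fun u v => \sum_g tens (gact B g v) (gproj A g u)).

Definition is_center_morphism A B (f : 'Hom(A, B)) :=
  (forall g, (f @: homog A g <= homog B g)%VS) /\
  (forall g u, f (gact A g u) = gact B g (f u)).

(* Left-parenthesized, starting from the unit object:
   V^n = ((1 (x) V) (x) ...) (x) V. *)
Fixpoint tpow A (n : nat) : gspace K gT :=
  if n is m.+1 then center_tensor (tpow A m) A else center_unit.

Definition invariants A : {vspace A} :=
  (homog A 1%g :&: \bigcap_g fixedSpace (gact A g))%VS.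

Definition Av A (u : A) : A := #|gT|%:R^-1 *: \sum_g gact A g u.

(* The generator sigma_{m+1} on V^(m+2), i.e. acting on the last two factors. *)
Definition braid_last A (m : nat) : 'End(tpow A m.+2) :=
  ((center_assoc (tpow A m) A A)^-1 \o
   (tmap \1 (center_braiding A A) \o center_assoc (tpow A m) A A))%VF.

(* The generator sigma_{i+1} on V^n: braid_last A i on V^(i+2), tensored with
   the identity of the remaining n - i - 2 factors. *)
Fixpoint braid_op A (n i : nat) : 'End(tpow A n) :=
  match n return 'End(tpow A n) with
  | 0 => \1%VF
  | n1.+1 =>
    (match n1 return 'End(tpow A n1) -> 'End(tpow A n1.+1) with
     | 0 => fun _ => \1%VF
     | m.+1 => fun s => if i == m then braid_last A m else tmap s \1%VF
     end) (braid_op A n1 i)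
  end.

Fixpoint tvec A (n : nat) : ('I_n -> A) -> tpow A n :=
  match n return ('I_n -> A) -> tpow A n with
  | 0 => fun _ => 1
  | m.+1 => fun u => tens (tvec (fun i => u (widen_ord (leqnSn m) i))) (u ord_max)
  end.

Fixpoint tline A (n : nat) : ('I_n -> {vspace A}) -> {vspace tpow A n} :=
  match n return ('I_n -> {vspace A}) -> {vspace tpow A n} with
  | 0 => fun _ => fullv
  | m.+1 => fun L =>
      tensv (tline (fun i => L (widen_ord (leqnSn m) i))) (L ord_max)
  end.

End Center.

(** * Monomial Yetter-Drinfeld modules *)

(* myd_perm and myd_deg are determined by the other fields, the lines being
   non-zero and in direct sum. *)
Record monomialYD (K : fieldType) (gT : finGroupType) (omega : cocycle3 K gT) :=
MonomialYD {
  myd_obj :> gspace K gT;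
  myd_objP : is_center_object omega myd_obj;
  myd_index : finType;
  myd_line : myd_index -> {vspace myd_obj};
  myd_line_dim : forall x, \dim (myd_line x) = 1%N;
  myd_line_direct : directv (\sum_x myd_line x)%VS;
  myd_line_full : (\sum_x myd_line x)%VS = fullv;
  myd_perm : gT -> {perm myd_index};
  myd_permP : forall g x, (gact myd_obj g @: myd_line x)%VS = myd_line (myd_perm g x);
  myd_deg : myd_index -> gT;
  myd_degP : forall x, (myd_line x <= homog myd_obj (myd_deg x))%VS }.

Section MonomialYD.
Variables (K : fieldType) (gT : finGroupType) (omega : cocycle3 K gT).
Variable V : monomialYD omega.
Let X := myd_index V.
Let V0 : gspace K gT := V.

Section Power.
Variable n : nat.
Implicit Types (x y : {ffun 'I_n -> X}) (g : gT).

Definition Gact g x : {ffun 'I_n -> X} := [ffun j => myd_perm V g (x j)].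

Definition Gorbit x : {set {ffun 'I_n -> X}} := [set Gact g x | g : gT].

(* |x_1| ... |x_j|, the product of the first j degrees. *)
Definition prefix_deg x (j : nat) : gT :=
  (\prod_(k < n | (k < j)%N) myd_deg (x k))%g.

Definition degree1 : {set {ffun 'I_n -> X}} := [set x | prefix_deg x n == 1%g].

Definition is_regular x :=
  [forall g, (Gact g x == x) ==>
    (tline omega (fun j => myd_line (x j))
       <= fixedSpace (gact (tpow omega V0 n) g))%VS].

Definition regulars : {set {ffun 'I_n -> X}} :=
  [set x in degree1 | is_regular x].

Definition is_orbit_reps (R : {set {ffun 'I_n -> X}}) :=
  R \subset regulars /\ {in regulars, forall y, #|R :&: Gorbit y| = 1%N}.

Definition orbit_proj (R : {set {ffun 'I_n -> X}}) y : {ffun 'I_n -> X} :=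
  odflt y [pick x in R :&: Gorbit y].

Lemma strand_subproof (i : 'I_n.-1) : (i < n)%N /\ (i.+1 < n)%N.
Proof. by case: n i => [|m] [i] //= im; split=> //; apply: ltnW. Qed.

(* The positions of the two strands crossed by the generator of index i. *)
Definition strand1 (i : 'I_n.-1) : 'I_n := Ordinal (strand_subproof i).1.
Definition strand2 (i : 'I_n.-1) : 'I_n := Ordinal (strand_subproof i).2.

Definition sigmaX (i : 'I_n.-1) x : {ffun 'I_n -> X} :=
  [ffun j => if j == strand1 i
             then myd_perm V (myd_deg (x (strand1 i))) (x (strand2 i))
             else if j == strand2 i then x (strand1 i) else x j].

End Power.

Section Scalars.
Variable v : X -> V0.

Definition basis_tensor n (x : {ffun 'I_n -> X}) : tpow omega V0 n :=
  tvec omega (fun j => v (x j)).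

(* The coefficient of g |> v_x on v_{gx}. *)
Definition lambdaX (g : gT) (x : X) : K :=
  coord [tuple v (myd_perm V g x)] ord0 (gact V0 g (v x)).

Lemma lambdaXP : (forall x, v x \in myd_line x /\ v x != 0) ->
  forall g x, gact V0 g (v x) = lambdaX g x *: v (myd_perm V g x).
Proof.
move=> hv g x; have [vx _] := hv x; have [vgx vgx0] := hv (myd_perm V g x).
have eL : (<[v (myd_perm V g x)]> = myd_line (myd_perm V g x))%VS.
  apply/eqP; rewrite eqEdim myd_line_dim dim_vline vgx0 andbT.
  by rewrite -memvE.
have := memv_img (gact V0 g) vx; rewrite myd_permP -eL => H.
have H' : gact V0 g (v x) \in <<[tuple v (myd_perm V g x)]>>%VS.
  by rewrite span_seq1.
by rewrite {1}(coord_span H') big_ord1.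
Qed.

Definition lambdaXn n (g : gT) (x : {ffun 'I_n -> X}) : K :=
  (\prod_j lambdaX g (x j)) *
  \prod_(j < n | (0 < j)%N) omega1 omega g (prefix_deg x j) (myd_deg (x j)).

(* The first factor involves the degrees of the new entries (sigmaX i x)_i and
   (sigmaX i x)_{i+1}; the former is |x_i| |x_{i+1}| |x_i|^-1. *)
Definition beta n (i : 'I_n.-1) (x : {ffun 'I_n -> X}) (g : gT) : K :=
  let p := prefix_deg x i in
  let x1 := x (strand1 i) in
  let x2 := x (strand2 i) in
  (omega p (myd_deg (myd_perm V (myd_deg x1) x2)) (myd_deg x1))^-1
  * lambdaX (myd_deg x1) x2
  * omega p (myd_deg x1) (myd_deg x2)
  * lambdaXn g (sigmaX i x).

End Scalars.
End MonomialYD.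

(* Main.v *)
From HB Require Import structures.
From mathcomp Require Import all_boot all_order all_fingroup all_algebra.
From mathcomp Require Import boolp reals complex ring.
Require Import Defs.

Set Implicit Arguments.
Unset Strict Implicit.
Unset Printing Implicit Defensive.

Import GRing.Theory.
Local Open Scope ring_scope.

(** The tensors v_x = v_(x_1) (x) ... (x) v_(x_n) form a basis of the n-th
    power of V, and both G and the braid generators act on it by monomial
    matrices:

      g |> v_x = lambda(g; x) v_(gx)       (gact_basis_tensor)
      sigma_i v_x = c_i(x) v_(sigma_i x)   (braid_op_basis)

    Everything follows from two properties of these scalars.

    First, lambda is multiplicative in g up to the factor omega2 (lambdaXnM),
    which is 1 in degree 1.  On tuples of degree 1 the twisted action is thus
    an honest monomial representation, and lambda(g; x) Av(v_(gx)) = Av(v_x).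
    If x is irregular, some g fixes x with lambda(g; x) <> 1, and Av(v_x) = 0;
    if x is regular, the coordinate of Av(v_x) on v_x is |Stab x| / |G|, which
    is non-zero in characteristic 0.  As Av(v_x) is supported on the orbit of
    x, the averages over a set of representatives of the regular orbits are
    independent, and they span the invariants because Av projects onto them
    (Av_basis_of).

    Second, the generators commute with the twisted action, that is,

      c_i(gx) lambda(g; x) = lambda(g; sigma_i x) c_i(x)

    (lambdaXn_sigmaX).  If g fixes x it also fixes sigma_i x, and the same
    scalar lambda occurs on both sides, so that sigma_i preserves regularity;
    it descends to orbits as it commutes with G.  With the braid relations on
    tuples, which come from |gx| = g |x| g^-1 (sigmaX_near), this is part (a).
    Summing over g gives
    sigma_i Av(v_x) = c_i(x) Av(v_(sigma_i x)), and moving sigma_i x to the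
    representative of its orbit multiplies by lambda(g; sigma_i x), whence the
    coefficient beta of part (b) (braid_op_Av).

    By recursion on the number of factors, the two properties of the scalars
    reduce to three identities between products of values of omega:
    omega1_omega2 (the tensor product of twisted actions is a twisted action),
    omega1_assoc (the associator is equivariant) and omega1_braiding (the
    braiding is equivariant). *)

(** * Cocycle identities *)

Section Cocycle.
Variables (K : fieldType) (gT : finGroupType) (omega : cocycle3 K gT).
Implicit Types (a b c d f g h k l : gT).

Lemma cocycle1l a b : omega 1%g a b = 1.
Proof.
have := cocycleM omega 1 1 a b; rewrite !mul1g !cocycle1 !mul1r mulr1 => e.
by apply/(mulfI (cocycle_neq0 omega 1 a b)); rewrite mulr1 -e.
Qed.

Lemma cocycle1r a b : omega a b 1%g = 1.
Proof.
have := cocycleM omega a b 1 1; rewrite !mul1g !mulg1 !cocycle1 mul1r mulr1 => e.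
by apply/(mulfI (cocycle_neq0 omega a b 1)); rewrite mulr1 -e.
Qed.

Lemma lconjM g h k : lconj (g * h) k = lconj g (lconj h k).
Proof. by rewrite /lconj invMg !mulgA. Qed.

Lemma lconjMr g h k : lconj g (h * k) = (lconj g h * lconj g k)%g.
Proof. by rewrite /lconj !mulgA mulgKV. Qed.

Lemma lconj1 g : lconj g 1 = 1%g.
Proof. by rewrite /lconj mulg1 mulgV. Qed.

Lemma lconjE g h : (lconj g h * g = g * h)%g.
Proof. by rewrite /lconj mulgKV. Qed.

Lemma omega2_neq0 g f h : omega2 omega g f h != 0.
Proof. by rewrite /omega2 !(mulf_eq0, invr_eq0) !negb_or !cocycle_neq0. Qed.

Lemma omega1_1 g h : omega1 omega g 1 h = 1.
Proof. by rewrite /omega1 lconj1 !cocycle1l cocycle1 !(mul1r, mulr1, invr1). Qed.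

Lemma omega2_1 g h : omega2 omega g h 1 = 1.
Proof.
by rewrite /omega2 !lconj1 cocycle1l cocycle1 cocycle1r !(mul1r, mulr1, invr1).
Qed.

(** The quotient of the two sides of the cocycle condition.  An identity
    between products of values of omega is proved by multiplying one side by a
    product of pentagons with exponents 1 and -1: clearing denominators then
    closes the goal. *)
Definition pentagon a b c d : K :=
  omega (a * b)%g c d * omega a b (c * d)%g
    / (omega a b c * omega a (b * c)%g d * omega b c d).

Lemma pentagonE a b c d : pentagon a b c d = 1.
Proof.
by rewrite /pentagon cocycleM divff // !mulf_eq0 !negb_or !cocycle_neq0.
Qed.

(** The equivariance of the associator: one pentagon for each of the four
    positions of g among the letters of the word (f, h, k), every letter being
    conjugated once g has moved past it, with alternating signs. *)
Lemma omega1_assoc g f h k :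
  omega1 omega g (f * h)%g k * omega1 omega g f h
    * omega (lconj g f) (lconj g h) (lconj g k)
  = omega f h k * omega1 omega g f (h * k)%g * omega1 omega g h k.
Proof.
rewrite -[RHS]mul1r.
have <- : pentagon g f h k * pentagon (lconj g f) (lconj g h) g k
    / pentagon (lconj g f) g h k
    / pentagon (lconj g f) (lconj g h) (lconj g k) g = 1.
  by rewrite !pentagonE !divr1 mulr1.
rewrite /pentagon /omega1 !lconjMr !lconjE.
by field; rewrite !cocycle_neq0.
Qed.

(** The compatibility of the twisted action with tensor products: one pentagon
    for each of the six shuffles of the words (g, h) and (f, k), where f and k
    are conjugated by the letters among g and h that have moved past them; the
    exponent is the sign of the shuffle. *)
Lemma omega1_omega2 g h f k :
  omega1 omega (g * h)%g f k * omega2 omega g h f * omega2 omega g h k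
  = omega2 omega g h (f * k)%g
      * omega1 omega g (lconj h f) (lconj h k) * omega1 omega h f k.
Proof.
rewrite -[LHS]mul1r.
have <- : pentagon g h f k / pentagon g (lconj h f) h k
    * pentagon g (lconj h f) (lconj h k) h
    * pentagon (lconj (g * h)%g f) g h k
    / pentagon (lconj (g * h)%g f) g (lconj h k) h
    * pentagon (lconj (g * h)%g f) (lconj (g * h)%g k) g h = 1.
  by rewrite !pentagonE ?divr1 ?mulr1.
rewrite /pentagon /omega1 /omega2 -!lconjM (lconjMr h f k) (lconjMr _ f k).
have e x : (lconj (g * h) x * g = g * lconj h x)%g by rewrite lconjM lconjE.
rewrite !e !lconjE.
by field; rewrite !cocycle_neq0.
Qed.

(** The equivariance of the braiding.  Both sides reduce to the same quotient
    once (lconj g f) g is replaced by g f. *)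
Lemma omega1_braiding g f k :
  omega1 omega g f k * omega2 omega g f k
  = omega1 omega g (lconj f k) f * omega2 omega (lconj g f) g k.
Proof.
rewrite /omega1 /omega2 -lconjM !lconjE.
by field; rewrite !cocycle_neq0.
Qed.

End Cocycle.

(** * Tensor products and dual bases *)

Section TensorBases.
Variable K : fieldType.
Implicit Types U V W : vectType K.

Lemma tens_linearl U V (v : V) : linear (fun u : U => tens u v).
Proof.
by move=> a u u'; apply/matrixP=> i j; rewrite !mxE linearP mulrDl mulrA.
Qed.

Lemma tens_linearr U V (u : U) : linear (tens (V := V) u).
Proof.
move=> a v v'; apply/matrixP=> i j; rewrite !mxE linearP mulrDr.
by rewrite mulrCA.
Qed.

HB.instance Definition _ U V (u : U) :=
  GRing.isLinear.Build K V (tensor U V) *:%R (tens u) (tens_linearr u).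

Lemma tensZl U V a (u : U) (v : V) : tens (a *: u) v = a *: tens u v.
Proof.
by apply/matrixP=> i j; rewrite !mxE linearZ mulrA.
Qed.

Lemma tensZr U V a (u : U) (v : V) : tens u (a *: v) = a *: tens u v.
Proof. by rewrite linearZ. Qed.

Lemma tens0l U V (v : V) : tens (0 : U) v = 0.
Proof. by rewrite -(scale0r 0) tensZl scale0r. Qed.

Lemma tens0r U V (u : U) : tens u (0 : V) = 0.
Proof. exact: linear0. Qed.

Lemma tens_suml U V (I : finType) (F : I -> U) (v : V) :
  tens (\sum_i F i) v = \sum_i tens (F i) v.
Proof.
by apply: (big_morph (fun u => tens u v)) => [u u'|]; rewrite ?tens0l //
   -[u in LHS]scale1r tens_linearl scale1r.
Qed.

Lemma tens_sumr U V (I : finType) (u : U) (F : I -> V) :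
  tens u (\sum_i F i) = \sum_i tens u (F i).
Proof. exact: linear_sum. Qed.

Lemma tmap_tens U V U' V' (f : 'Hom(U, U')) (g : 'Hom(V, V')) u v :
  tmap f g (tens u v) = tens (f u) (g v).
Proof.
rewrite /tmap tlift_tens // => [y a x x'|x a y y']; rewrite linearP.
  exact: tens_linearl.
exact: tens_linearr.
Qed.

Lemma memv_tensv U V (A : {vspace U}) (B : {vspace V}) u v :
  u \in A -> v \in B -> tens u v \in tensv A B.
Proof.
move=> /coord_vbasis -> /coord_vbasis ->.
rewrite tens_suml; apply: memv_suml => i _; rewrite tens_sumr.
apply: memv_suml => j _; rewrite tensZl tensZr !memvZ // memv_span //.
by apply/allpairsP; exists ((vbasis A)`_i, (vbasis B)`_j);
  rewrite !mem_nth ?size_tuple.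
Qed.

Lemma tensv_subvP U V (A : {vspace U}) (B : {vspace V}) (C : {vspace tensor U V}) :
  (forall u v, u \in A -> v \in B -> tens u v \in C) -> (tensv A B <= C)%VS.
Proof.
move=> sub; apply/span_subvP => _ /allpairsP[[u v] /= [uA vB ->]].
by apply: sub; apply: vbasis_mem.
Qed.

Lemma tensv_line U V (u : U) (v : V) : (tensv <[u]> <[v]> = <[tens u v]>)%VS.
Proof.
apply/eqP; rewrite eqEsubv -memvE memv_tensv ?memv_line // andbT.
apply: tensv_subvP => _ _ /vlineP[a ->] /vlineP[b ->].
by rewrite tensZl tensZr !memvZ ?memv_line.
Qed.

(** Dual bases are carried as explicit coordinate functionals rather than as
    tuples, so that bases can be indexed by an arbitrary finite type. *)
Record dual_basis U (I : finType) (b : I -> U) (d : I -> 'Hom(U, K^o)) : Prop :=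
  DualBasis {
    dual_delta : forall i j, d i (b j) = (i == j)%:R;
    dual_expand : forall u, u = \sum_i (d i u : K) *: b i }.

Lemma dual_sum U (I : finType) (b : I -> U) d (c : I -> K) j :
  dual_basis b d -> d j (\sum_i c i *: b i) = c j.
Proof.
move=> bd; rewrite linear_sum (bigD1 j) //= linearZ /= (dual_delta bd) eqxx.
rewrite [_ *: _]mulr1 big1 ?addr0 // => i neq.
by rewrite linearZ /= (dual_delta bd) eq_sym (negbTE neq) scaler0.
Qed.

(** With scale_on, the projections to the lines of a basis are composites of
    linear maps, so that their sum can be compared with the identity on pure
    tensors alone. *)
Definition scale_on U (x : U) (a : K^o) : U := (a : K) *: x.

Lemma scale_on_linear U (x : U) : linear (scale_on x).
Proof. by move=> a b c; rewrite /scale_on scalerDl scalerA. Qed.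

HB.instance Definition _ U (x : U) :=
  GRing.isLinear.Build K K^o U *:%R (scale_on x) (scale_on_linear x).

Definition tens_coord U V (f : 'Hom(U, K^o)) (g : 'Hom(V, K^o)) :
  'Hom(tensor U V, K^o) := tlift (fun u v => f u * g v).

Lemma tens_coordE U V (f : 'Hom(U, K^o)) (g : 'Hom(V, K^o)) u v :
  tens_coord f g (tens u v) = f u * g v.
Proof.
rewrite /tens_coord tlift_tens // => [y a x x'|x a y y']; rewrite linearP.
  by rewrite mulrDl -scalerAl.
by rewrite mulrDr -scalerAr.
Qed.

(** The index type L is only required to be in bijection with I * J, so that
    tuples of length n + 1 can index the tensors of tuples of length n with
    letters. *)
Lemma dual_basis_tens U V (I J L : finType) (p : L -> I) (q : L -> J)
    (b : I -> U) d (c : J -> V) e :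
  bijective (fun l => (p l, q l)) -> dual_basis b d -> dual_basis c e ->
  dual_basis (fun l => tens (b (p l)) (c (q l)))
             (fun l => tens_coord (d (p l)) (e (q l))).
Proof.
move=> pq bd ce; split=> [l l'|w].
  rewrite tens_coordE (dual_delta bd) (dual_delta ce) -natrM mulnb.
  by rewrite -[_ && _]/((p l, q l) == (p l', q l')) (bij_eq pq).
pose F l := (linfun (scale_on (tens (b (p l)) (c (q l))))
               \o tens_coord (d (p l)) (e (q l)))%VF.
have FE l z : F l z = (tens_coord (d (p l)) (e (q l)) z : K)
                        *: tens (b (p l)) (c (q l)).
  by rewrite comp_lfunE lfunE.
suff idE : \1%VF = \sum_l F l.
  rewrite -[LHS]id_lfunE idE sum_lfunE; apply: eq_bigr => l _; exact: FE.
apply: tens_hom_ext => u v; rewrite id_lfunE sum_lfunE.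
rewrite {1}(dual_expand bd u) {1}(dual_expand ce v) tens_suml.
under eq_bigr do rewrite tens_sumr.
rewrite pair_big (reindex _ (onW_bij _ pq)); apply: eq_bigr => l _ /=.
by rewrite FE tens_coordE tensZl tensZr scalerA.
Qed.

End TensorBases.

(** * Graded spaces with a homogeneous basis *)

Section GradedBases.
Variables (K : fieldType) (gT : finGroupType) (omega : cocycle3 K gT).
Implicit Types (A B C : gspace K gT) (g h k : gT).

(** Directness and exhaustiveness of the grading both follow from this
    description of the homogeneous components by coordinates, which passes
    easily to tensor products. *)
Record graded_basis A (I : finType) (b : I -> A) (d : I -> 'Hom(A, K^o))
    (deg : I -> gT) : Prop := GradedBasis {
  graded_dual : dual_basis b d;
  graded_homog : forall g u,
    u \in homog A g <-> (forall i, d i u != 0 -> deg i = g) }.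

(** The only property of the grading used to evaluate the tensor action, the
    braiding and the associator, all of which are defined through gproj. *)
Definition graded A := forall g h u,
  u \in homog A h -> gproj A g u = if g == h then u else 0.

Lemma graded_basis_mem A (I : finType) (b : I -> A) d deg i :
  graded_basis b d deg -> b i \in homog A (deg i).
Proof.
case=> bd hb; apply/hb => j; rewrite (dual_delta bd).
by case: (j =P i) => [->|_] //; rewrite eqxx.
Qed.

Lemma graded_basis_full A (I : finType) (b : I -> A) d deg :
  graded_basis b d deg -> (\sum_g homog A g)%VS = fullv.
Proof.
move=> gb; apply/vspaceP => u; rewrite memvf; apply/idP.
rewrite (dual_expand (graded_dual gb) u) memv_suml // => i _.
apply: memvZ; apply: subvP (graded_basis_mem i gb).
exact: sumv_sup.
Qed.

(** The i-th coordinate vanishes on every component other than that of degree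
    deg i, so applying it to u = \sum_g gproj g u isolates one projection. *)
Lemma graded_basis_graded A (I : finType) (b : I -> A) d deg :
  graded_basis b d deg -> graded A.
Proof.
move=> gb; have [bd hb] := gb.
have projE g u i : d i (gproj A g u) = (g == deg i)%:R * d i u.
  pose P g := sumv_pi (\sum_g homog A g)%VS g.
  have Pg g' w : P g' w \in homog A g' by apply: memv_sum_pi.
  have P0 g' w : g' != deg i -> d i (P g' w) = 0.
    move=> neq; apply/eqP; apply: contra_neqT neq => nz.
    by rewrite ((hb g' (P g' w)).1 (Pg _ _) _ nz).
  rewrite /gproj lfunE /= -/(P g); case: eqP => [->|/eqP neq]; last first.
    by rewrite mul0r P0.
  have uE : \sum_g P g u = u.
    by apply: sumv_pi_sum; rewrite (graded_basis_full gb) memvf.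
  rewrite mul1r -[in RHS]uE linear_sum (bigD1 (deg i)) //= big1 ?addr0 //.
  by move=> j; apply: P0.
move=> g h u /hb uh; rewrite (dual_expand bd (gproj A g u)).
case: eqP => [->|neq].
  rewrite [RHS](dual_expand bd u); apply: eq_bigr => i _; rewrite projE.
  have [->|/uh ->] := eqVneq (d i u) 0; first by rewrite mulr0.
  by rewrite eqxx mul1r.
rewrite big1 // => i _; rewrite projE.
have [->|/uh ->] := eqVneq (d i u) 0; first by rewrite mulr0 scale0r.
by case: eqP => // _; rewrite mul0r scale0r.
Qed.

Lemma gact_tens A B g h k u v :
    graded A -> graded B -> u \in homog A h -> v \in homog B k ->
  gact (center_tensor omega A B) g (tens u v) =
  omega1 omega g h k *: tens (gact A g u) (gact B g v).
Proof.
move=> gA gB uh vk; rewrite /= tlift_tens.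
- rewrite (bigD1 h) //= (bigD1 k) //= (gA h h) // (gB k k) // !eqxx.
  rewrite big1 => [|l /negbTE neq]; last first.
    by rewrite (gB l k) // neq linear0 tens0r scaler0.
  rewrite big1 => [|l /negbTE neq]; first by rewrite !addr0.
  by rewrite big1 // => m _; rewrite (gA l h) // neq linear0 tens0l scaler0.
- move=> w a x y; rewrite scaler_sumr -big_split; apply: eq_bigr => l _ /=.
  rewrite scaler_sumr -big_split; apply: eq_bigr => m _ /=.
  by rewrite !linearP tens_linearl scalerDr !scalerA mulrC.
- move=> w a x y; rewrite scaler_sumr -big_split; apply: eq_bigr => l _ /=.
  rewrite scaler_sumr -big_split; apply: eq_bigr => m _ /=.
  rewrite (linearP (gproj B m)) (linearP (gact B g)) tens_linearr.
  by rewrite scalerDr !scalerA mulrC.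
Qed.

Lemma center_braiding_tens A B g u v : graded A -> u \in homog A g ->
  center_braiding omega A B (tens u v) = tens (gact B g v) u.
Proof.
move=> gA ug; rewrite /center_braiding tlift_tens.
- rewrite (bigD1 g) //= (gA g g) // eqxx big1 ?addr0 // => l /negbTE neq.
  by rewrite (gA l g) // neq tens0r.
- move=> w a x y; rewrite scaler_sumr -big_split; apply: eq_bigr => l _ /=.
  by rewrite !linearP.
- move=> w a x y; rewrite scaler_sumr -big_split; apply: eq_bigr => l _ /=.
  by rewrite !linearP tens_linearl.
Qed.

Lemma center_assoc_tens A B C g h k u v w :
    graded A -> graded B -> graded C ->
    u \in homog A g -> v \in homog B h -> w \in homog C k ->
  center_assoc omega A B C (tens (tens u v) w) =
  omega g h k *: tens u (tens v w).
Proof.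
move=> gA gB gC ug vh wk.
pose F (w : C) (u : A) (v : B) := \sum_g \sum_h \sum_k
    omega g h k *: tens (gproj A g u) (tens (gproj B h v) (gproj C k w)).
have F1 x y : linear (F x ^~ y).
  move=> a z t; rewrite /F.
  do 3!(rewrite scaler_sumr -big_split; apply: eq_bigr => ? _ /=).
  by rewrite !linearP tens_linearl scalerDr !scalerA mulrC.
have F2 x y : linear (F x y).
  move=> a z t; rewrite /F.
  do 3!(rewrite scaler_sumr -big_split; apply: eq_bigr => ? _ /=).
  by rewrite (linearP (gproj B _)) tens_linearl tens_linearr scalerDr !scalerA
    mulrC.
have F3 y z : linear (fun x => F x y z).
  move=> a x t; rewrite /F.
  do 3!(rewrite scaler_sumr -big_split; apply: eq_bigr => ? _ /=).
  by rewrite (linearP (gproj C _)) !tens_linearr scalerDr !scalerA mulrC.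
(* The inner lift depends linearly on w, as seen on pure tensors. *)
rewrite /center_assoc tlift_tens; first last.
- move=> p a x y; rewrite -!/(F _).
  have -> : tlift (F (a *: x + y)) = a *: tlift (F x) + tlift (F y).
    apply: tens_hom_ext => s t; rewrite add_lfunE scale_lfunE.
    rewrite !tlift_tens //; exact: F3.
  by rewrite add_lfunE scale_lfunE.
- by move=> x a y z; rewrite linearP.
rewrite tlift_tens //; try exact: F1; try exact: F2.
rewrite -/(F w u v) /F (bigD1 g) //= (bigD1 h) //= (bigD1 k) //=.
rewrite (gA g g) // (gB h h) // (gC k k) // !eqxx.
rewrite big1 => [|l /negbTE neq]; last first.
  by rewrite (gC l k) // neq !tens0r scaler0.
rewrite big1 => [|l /negbTE neq]; last first.
  by rewrite big1 // => m _; rewrite (gB l h) // neq tens0l tens0r scaler0.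
rewrite big1 => [|l /negbTE neq]; first by rewrite !addr0.
rewrite big1 // => m _; rewrite big1 // => m' _.
by rewrite (gA l g) // neq tens0l scaler0.
Qed.

Lemma homog_tens A B g h u v : u \in homog A g -> v \in homog B h ->
  tens u v \in homog (center_tensor omega A B) (g * h)%g.
Proof.
move=> ug vh; apply: (subvP (sumv_sup g _ (subvv _))) => //.
by apply: memv_tensv; rewrite ?mulKg.
Qed.

Lemma graded_basis_tens A B (I J L : finType) (p : L -> I) (q : L -> J)
    (b : I -> A) d degA (c : J -> B) e degB :
    bijective (fun l => (p l, q l)) ->
    graded_basis b d degA -> graded_basis c e degB ->
  graded_basis (A := center_tensor omega A B)
    (fun l => tens (b (p l)) (c (q l)))
    (fun l => tens_coord (d (p l)) (e (q l)))
    (fun l => degA (p l) * degB (q l))%g.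
Proof.
move=> pq gb gc; have [bd bh] := gb; have [ce ch] := gc.
have bc := dual_basis_tens pq bd ce.
split=> // g w; split=> [|wg].
  case/memv_sumP => f fh -> l; rewrite linear_sum /= => nz.
  have [h nzh|z] := pickP (fun h => tens_coord (d (p l)) (e (q l)) (f h) != 0);
    last by rewrite big1 ?eqxx // in nz => h _; apply/eqP/negbFE/z.
  apply/eqP; apply: contraT => neq; case/eqP: nzh; apply/eqP.
  rewrite -memv_ker; apply: subvP (fh h isT); apply: tensv_subvP => u v uh vh.
  rewrite memv_ker tens_coordE mulf_eq0; apply: contraNT neq.
  rewrite negb_or => /andP[/((bh _ _).1 uh) -> /((ch _ _).1 vh) ->].
  by rewrite mulKVg.
rewrite (dual_expand bc w) memv_suml // => l _.
have [->|/wg <-] := eqVneq (tens_coord (d (p l)) (e (q l)) w) 0.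
  by rewrite scale0r mem0v.
by rewrite memvZ // homog_tens // (graded_basis_mem _ gb, graded_basis_mem _ gc).
Qed.

(** The associator is diagonal with non-zero entries between the two bases of
    triple tensors. *)
Lemma center_assoc_inj A B C (I J L : finType)
    (b : I -> A) d degA (c : J -> B) e degB (a : L -> C) f degC :
    graded_basis b d degA -> graded_basis c e degB -> graded_basis a f degC ->
  lker (center_assoc omega A B C) == 0%VS.
Proof.
move=> gb gc ga.
have ij : bijective (fun p : I * J => (p.1, p.2)) by exists id; case.
have ijl : bijective (fun p : I * J * L => (p.1, p.2)) by exists id; case.
have jl : bijective (fun p : I * J * L => (p.1.1, (p.1.2, p.2))).
  by exists (fun q => ((q.1, q.2.1), q.2.2)) => [[[]]|[? []]].
have gl := graded_basis_tens ijl (graded_basis_tens ij gb gc) ga.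
have jl' : bijective (fun p : J * L => (p.1, p.2)) by exists id; case.
have gr := graded_basis_tens jl gb (graded_basis_tens jl' gc ga).
apply/eqP; apply/vspaceP => w; rewrite memv0 memv_ker.
apply/idP/eqP=> [/eqP|->]; last by rewrite linear0.
rewrite [X in center_assoc _ _ _ _ X](dual_expand (graded_dual gl) w).
rewrite linear_sum /=.
under eq_bigr => l _.
  rewrite linearZ /= (center_assoc_tens (graded_basis_graded gb)
    (graded_basis_graded gc) (graded_basis_graded ga)
    (graded_basis_mem _ gb) (graded_basis_mem _ gc) (graded_basis_mem _ ga)).
  rewrite scalerA; over.
move=> w0; rewrite (dual_expand (graded_dual gl) w) big1 // => l _.
have := congr1 (tens_coord (d l.1.1) (tens_coord (e l.1.2) (f l.2))) w0.
rewrite linear0 (dual_sum _ _ (graded_dual gr)).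
rewrite -[RHS](mul0r (omega (degA l.1.1) (degB l.1.2) (degC l.2))).
by move/(mulIf (cocycle_neq0 omega _ _ _)) => ->; rewrite scale0r.
Qed.

End GradedBases.

(** * Braid group actions on finite sets *)

Section Words.
Variables (T : finType) (n : nat) (s : 'I_n.-1 -> T -> T).
Hypothesis s_inj : forall i, injective (s i).
Hypothesis s_far : forall i j : 'I_n.-1, (i.+1 < j)%N ->
  forall x, s i (s j x) = s j (s i x).
Hypothesis s_near : forall i j : 'I_n.-1, i.+1 = j :> nat ->
  forall x, s i (s j (s i x)) = s j (s i (s j x)).

(** finv inverts an injective self-map of a finite type as one of its
    iterates. *)
Definition letter_act (a : 'I_n.-1 * bool) : T -> T :=
  if a.2 then s a.1 else finv (s a.1).

(** Words act from the right end, as befits a left action. *)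
Definition word_act (u : braid_word n) (x : T) : T := foldr letter_act x u.

Definition braid_act (b : braid n) : T -> T := word_act (braid_repr b).

Lemma word_act_cat u w x : word_act (u ++ w) x = word_act u (word_act w x).
Proof. exact: foldr_cat. Qed.

Lemma word_act_rel u w : braid_rel u w -> word_act u =1 word_act w.
Proof.
elim=> {u w} /=.
- by [].
- by move=> u w _ uw x; rewrite uw.
- by move=> u w w' _ uw _ ww' x; rewrite uw.
- by move=> u u' w w' _ uu' _ ww' x; rewrite !word_act_cat ww' uu'.
- move=> i [] x; rewrite /word_act /= /letter_act /=.
    exact: f_finv.
  exact: finv_f.
- by move=> i j ij x; apply: s_far.
- by move=> i j ij x; apply: s_near.
Qed.

Lemma braid_act_word u : braid_act (braid_of_word u) =1 word_act u.
Proof. exact/word_act_rel/repr_braid. Qed.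

Lemma braid_act_gen i x : braid_act (braid_gen i) x = s i x.
Proof. exact: braid_act_word. Qed.

Lemma braid_act1 x : braid_act 1%g x = x.
Proof. exact: braid_act_word. Qed.

Lemma braid_actM b c x : braid_act (b * c)%g x = braid_act b (braid_act c x).
Proof.
rewrite -[b]repr_braidK -[c]repr_braidK.
by rewrite [(_ * _)%g]braid_mul_word !braid_act_word word_act_cat.
Qed.

(** Stability under the inverses of the generators is automatic: they are
    iterates of the generators, which permute a finite set. *)
Lemma braid_act_closed (S : {set T}) :
  (forall i, {in S, forall x, s i x \in S}) ->
  forall b, {in S, forall x, braid_act b x \in S}.
Proof.
move=> sS b x xS; rewrite /braid_act.
elim: (braid_repr b) => //= -[i []] u; rewrite /letter_act /=; first exact: sS.
by rewrite /finv; elim: (fingraph.order _ _).-1 => //= m IHm uS; apply/sS/IHm.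
Qed.

Lemma braid_act_comm (f : T -> T) :
  (forall i x, s i (f x) = f (s i x)) ->
  forall b x, braid_act b (f x) = f (braid_act b x).
Proof.
move=> sf b x; rewrite /braid_act.
elim: (braid_repr b) => //= -[i []] u ->; rewrite /letter_act /= ?sf //.
by apply: (@s_inj i); rewrite sf !f_finv.
Qed.

End Words.

(** * Monomial objects in the basis v *)

Lemma directv_component (K : fieldType) (W : vectType K) (I : finType)
    (Us : I -> {vspace W}) (us : I -> W) j u :
    directv (\sum_i Us i)%VS -> (forall i, us i \in Us i) -> u \in Us j ->
  \sum_i us i = u -> forall i, us i = if i == j then u else 0.
Proof.
move=> /directv_sum_unique uniq usU uU sumu i.
have := uniq us (fun i => if i == j then u else 0) (fun i _ => usU i).
rewrite -big_mkcond big_pred1_eq sumu eqxx => /(_ _)/esym/forall_inP.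
move=> eqs; apply/eqP/eqs => // k _.
by case: eqP => [->|_]; rewrite ?mem0v.
Qed.

Section MonomialObject.
Variables (K : fieldType) (gT : finGroupType) (omega : cocycle3 K gT).
Variable V : monomialYD omega.
Let X := myd_index V.
Variable v : X -> V.
Hypothesis hv : forall x, v x \in myd_line x /\ v x != 0.
Implicit Types (g h : gT) (x y : X).

Lemma myd_lineE x : myd_line x = <[v x]>%VS.
Proof.
have [vx vx0] := hv x.
by apply/esym/eqP; rewrite eqEdim myd_line_dim dim_vline vx0 andbT -memvE.
Qed.

Definition myd_coord x : 'Hom(V, K^o) :=
  (linfun (coord [tuple v x] ord0 : V -> K^o)
     \o sumv_pi (\sum_x myd_line x)%VS x)%VF.

Lemma myd_dual_basis : dual_basis v myd_coord.
Proof.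
pose P x := sumv_pi (\sum_x myd_line x)%VS x.
have PE x u : P x u = (myd_coord x u : K) *: v x.
  have : P x u \in <<[tuple v x]>>%VS.
    by rewrite span_seq1 -myd_lineE memv_sum_pi.
  move/coord_span; rewrite big_ord1 /= => {1}->.
  by rewrite /myd_coord comp_lfunE lfunE.
have expand u : u = \sum_x (myd_coord x u : K) *: v x.
  under eq_bigr do rewrite -PE.
  by rewrite sumv_pi_sum // (myd_line_full V) memvf.
split=> // x y; have [_ vx0] := hv x.
have : P x (v y) = if x == y then v y else 0.
  apply: (directv_component (us := P ^~ (v y)) (myd_line_direct V) _ (hv y).1).
    by move=> z; apply: memv_sum_pi.
  by rewrite sumv_pi_sum // (myd_line_full V) memvf.
rewrite PE.
case: eqP => [->|_]; last first.
  by move/eqP; rewrite scaler_eq0 (negbTE vx0) orbF => /eqP.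
move/eqP; rewrite -subr_eq0 -[X in _ - X]scale1r -scalerBl scaler_eq0.
by case: (hv y) => _ /negbTE ->; rewrite orbF subr_eq0 => /eqP.
Qed.

(** Splitting the expansion of a homogeneous vector by degree, uniqueness of
    homogeneous components kills the coordinates of the other degrees. *)
Lemma myd_graded_basis : graded_basis v myd_coord (@myd_deg _ _ _ V).
Proof.
have [dir full _ _ _] := myd_objP V.
have bd := myd_dual_basis.
have vh x : v x \in homog V (myd_deg x).
  by apply: subvP (myd_degP x) _ _; case: (hv x).
split=> // g u; split=> [ug x nz|ug]; last first.
  rewrite (dual_expand bd u) memv_suml // => x _.
  by have [->|/ug <-] := eqVneq (myd_coord x u) 0; rewrite ?scale0r ?mem0v ?memvZ.
pose us h : V := \sum_(x | myd_deg x == h) (myd_coord x u : K) *: v x.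
have : us (myd_deg x) = if myd_deg x == g then u else 0.
  apply: directv_component dir _ ug _ _ => [h|].
    by apply: memv_suml => y /eqP <-; rewrite memvZ.
  by rewrite [RHS](dual_expand bd u) (partition_big (@myd_deg _ _ _ V) xpredT).
case: eqP => // _ /(congr1 (myd_coord x)); rewrite linear0 /us big_mkcond /=.
under eq_bigr => y _.
  rewrite (_ : (if _ then _ else _) =
    (if myd_deg y == myd_deg x then myd_coord y u : K else 0) *: v y); last first.
    by case: eqP; rewrite ?scale0r.
  over.
by rewrite (dual_sum _ _ bd) eqxx => e; rewrite e eqxx in nz.
Qed.

Lemma lambdaX_neq0 g x : lambdaX v g x != 0.
Proof.
apply/eqP => l0; have := myd_permP g x.
rewrite myd_lineE limg_line (lambdaXP hv) l0 scale0r => e.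
by have := myd_line_dim (myd_perm V g x); rewrite -e dim_vline eqxx.
Qed.

Lemma basis_line_inj a b x y : a != 0 -> a *: v x = b *: v y -> x = y /\ a = b.
Proof.
move=> a0 e; have := congr1 (myd_coord x) e.
rewrite !linearZ /= !(dual_delta myd_dual_basis) eqxx.
rewrite [a *: _]mulr1; case: (x =P y) => [-> ->|_ a0']; last first.
  by rewrite a0' scaler0 eqxx in a0.
by split=> //; rewrite [_ *: _]mulr1.
Qed.

Lemma myd_deg_perm g x : myd_deg (myd_perm V g x) = lconj g (myd_deg x).
Proof.
have [_ _ _ _ hg] := myd_objP V.
have gb := myd_graded_basis.
have := subvP (hg g (myd_deg x)) _ (memv_img _ (graded_basis_mem x gb)).
rewrite (lambdaXP hv) => /(graded_homog gb); apply.
rewrite linearZ /= (dual_delta myd_dual_basis) eqxx [_ *: _]mulr1.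
exact: lambdaX_neq0.
Qed.

(** Both statements come from comparing the two expressions of (gh) |> v_x,
    which lie on the lines of (gh)x and of g(hx). *)
Lemma lambdaX_permM g h x :
  myd_perm V (g * h)%g x = myd_perm V g (myd_perm V h x) /\
  lambdaX v (g * h) x =
    omega2 omega g h (myd_deg x)
      * (lambdaX v g (myd_perm V h x) * lambdaX v h x).
Proof.
have [_ _ _ mul _] := myd_objP V.
have := mul g h _ _ (graded_basis_mem x myd_graded_basis).
rewrite !(lambdaXP hv) linearZ /= (lambdaXP hv) !scalerA.
case/(basis_line_inj (lambdaX_neq0 _ _)) => -> ->; split=> //.
by rewrite -mulrA; congr (_ * _); exact: mulrC.
Qed.

Lemma myd_perm1 x : myd_perm V 1%g x = x.
Proof.
have [_ _ one _ _] := myd_objP V.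
have := one (v x); rewrite (lambdaXP hv) -[in RHS](scale1r (v x)).
by case/(basis_line_inj (lambdaX_neq0 _ _)).
Qed.

Lemma myd_permM g h x : myd_perm V (g * h)%g x = myd_perm V g (myd_perm V h x).
Proof. by case: (lambdaX_permM g h x). Qed.

Lemma lambdaXM g h x :
  lambdaX v (g * h) x =
    omega2 omega g h (myd_deg x)
      * (lambdaX v g (myd_perm V h x) * lambdaX v h x).
Proof. by case: (lambdaX_permM g h x). Qed.

End MonomialObject.

(** * Tensor powers *)

Definition ffinit (T : Type) n (x : {ffun 'I_n.+1 -> T}) : {ffun 'I_n -> T} :=
  [ffun j => x (widen_ord (leqnSn n) j)].

Lemma ffinit_bij (T : Type) n :
  bijective (fun x : {ffun 'I_n.+1 -> T} => (ffinit x, x ord_max)).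
Proof.
exists (fun p : {ffun 'I_n -> T} * T =>
  [ffun j => oapp p.1 p.2 (unlift ord_max j)]) => [x|[y a]].
  apply/ffunP=> j; rewrite ffunE; case: unliftP => [k ->|->] //=.
  by rewrite ffunE; congr (x _); apply: ord_inj; rewrite lift_max.
congr (_, _); last by rewrite ffunE unlift_none.
apply/ffunP => j; rewrite !ffunE.
have -> : widen_ord (leqnSn n) j = lift ord_max j.
  by apply: ord_inj; rewrite lift_max.
by rewrite liftK.
Qed.

Section Powers.
Variables (K : fieldType) (gT : finGroupType) (omega : cocycle3 K gT).
Variable V : monomialYD omega.
Let X := myd_index V.
Variable v : X -> V.
Hypothesis hv : forall x, v x \in myd_line x /\ v x != 0.
Implicit Types (g h : gT).

Lemma prefix_deg_init n (x : {ffun 'I_n.+1 -> X}) j : (j <= n)%N ->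
  prefix_deg (ffinit x) j = prefix_deg x j.
Proof.
move=> jn; rewrite /prefix_deg [RHS]big_mkcond big_ord_recr /= ltnNge jn mulg1.
by rewrite -big_mkcond; apply: eq_bigr => k _; rewrite ffunE.
Qed.

Lemma prefix_degS n (x : {ffun 'I_n.+1 -> X}) :
  prefix_deg x n.+1 = (prefix_deg x n * myd_deg (x ord_max))%g.
Proof.
rewrite -(prefix_deg_init x (leqnn n)) /prefix_deg big_mkcond big_ord_recr /= ltnSn.
rewrite -big_mkcond; congr (_ * _)%g; apply: eq_big => [k|k _].
  by rewrite ltn_ord ltnS ltnW.
by rewrite ffunE.
Qed.

Lemma prefix_deg0 n (x : {ffun 'I_n -> X}) : prefix_deg x 0 = 1%g.
Proof. exact: big_pred0. Qed.

Lemma tvec_ext n (u w : 'I_n -> V) : u =1 w -> tvec omega u = tvec omega w.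
Proof.
elim: n u w => //= n IHn u w uw; rewrite uw; congr tens.
by apply: IHn => i; apply: uw.
Qed.

Lemma basis_tensorS n (x : {ffun 'I_n.+1 -> X}) :
  basis_tensor v x =
  tens (basis_tensor v (ffinit x) : tpow omega V n) (v (x ord_max)).
Proof.
by rewrite /basis_tensor /=; congr tens; apply: tvec_ext => i; rewrite ffunE.
Qed.

Lemma Gact_init n g (x : {ffun 'I_n.+1 -> X}) :
  ffinit (Gact g x) = Gact g (ffinit x).
Proof. by apply/ffunP => j; rewrite !ffunE. Qed.

Lemma prefix_deg_Gact n g (x : {ffun 'I_n -> X}) j :
  prefix_deg (Gact g x) j = lconj g (prefix_deg x j).
Proof.
rewrite /prefix_deg; elim/big_rec2: _ => [|k a b _ ->]; first by rewrite lconj1.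
by rewrite lconjMr ffunE (myd_deg_perm hv).
Qed.

(** lambdaXn omits the factor omega1 of the first letter, whereas the tensor
    power starts from the unit object and has one for every letter; the extra
    factor is omega1 g 1 _ = 1. *)
Lemma lambdaXnS n g (x : {ffun 'I_n.+1 -> X}) :
  lambdaXn v g x = lambdaXn v g (ffinit x) * lambdaX v g (x ord_max)
    * omega1 omega g (prefix_deg x n) (myd_deg (x ord_max)).
Proof.
rewrite /lambdaXn big_ord_recr /= [in LHS](big_mkcond (fun j => 0 < _)%N).
rewrite big_ord_recr /= -big_mkcond /=.
have -> : (if (0 < n)%N
    then omega1 omega g (prefix_deg x n) (myd_deg (x ord_max)) else 1)
  = omega1 omega g (prefix_deg x n) (myd_deg (x ord_max)).
  have deg1 m : m = 0%N -> prefix_deg x m = 1%g by move=> ->; apply: prefix_deg0.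
  by case: posnP => // /deg1 ->; rewrite omega1_1.
rewrite mulrACA mulrA; congr (_ * _).
congr (_ * _ * _); apply: eq_bigr => j _; rewrite ffunE //.
by rewrite prefix_deg_init // ltnW.
Qed.

(** The coordinate functionals are iterated tensor products of those of V. *)
Lemma graded_basis_tpow n : exists d,
  graded_basis (A := tpow omega V n) (basis_tensor v (n := n)) d
    (fun x => prefix_deg x n).
Proof.
elim: n => [|n [d IHn]].
  pose d (_ : {ffun 'I_0 -> X}) : 'Hom(K^o, K^o) := \1%VF.
  have x0 (x y : {ffun 'I_0 -> X}) : x = y by apply/ffunP => -[].
  exists d; split=> [|g u].
    split=> [i j|u]; first by rewrite (x0 i j) eqxx id_lfunE.
    have [x _] : exists x : {ffun 'I_0 -> X}, True.
      by exists (ffun0 (card_ord 0)).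
    rewrite (big_pred1 x) => [|y]; last by rewrite /= (x0 y x) eqxx.
    by rewrite id_lfunE [_ *: _]mulr1.
  have deg1 x : @prefix_deg _ _ _ V 0 x 0 = 1%g by apply: big_ord0.
  rewrite /=; split=> [|H].
    case: eqP => [-> // |_]; rewrite memv0 => /eqP -> i.
    by rewrite linear0 eqxx.
  case: eqP => [|neq]; first by rewrite memvf.
  rewrite memv0; apply: contraT => nz; case: neq.
  have := H (ffun0 (card_ord 0)); rewrite id_lfunE deg1 => -> //.
have := graded_basis_tens omega (@ffinit_bij X n) IHn (myd_graded_basis hv).
move=> gb; eexists.
have -> : basis_tensor v (n := n.+1) =
    fun l => tens (basis_tensor v (ffinit l) : tpow omega V n) (v (l ord_max)).
  by apply: funext => x; rewrite basis_tensorS.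
have -> : (fun x : {ffun 'I_n.+1 -> X} => prefix_deg x n.+1) =
  fun l => (prefix_deg (ffinit l) n * myd_deg (l ord_max))%g.
  by apply: funext => x; rewrite prefix_degS prefix_deg_init.
exact: gb.
Qed.

Lemma graded_tpow n : graded (tpow omega V n).
Proof. by have [d /graded_basis_graded] := graded_basis_tpow n. Qed.

Lemma graded_myd : graded V.
Proof. exact: graded_basis_graded (myd_graded_basis hv). Qed.

Lemma basis_tensor_homog n (x : {ffun 'I_n -> X}) :
  basis_tensor v x \in homog (tpow omega V n) (prefix_deg x n).
Proof. by have [d gb] := graded_basis_tpow n; apply: (graded_basis_mem x gb). Qed.

Lemma basis_homog x : v x \in homog V (myd_deg x).
Proof. exact: graded_basis_mem (myd_graded_basis hv). Qed.

Lemma gact_basis_tensor n g (x : {ffun 'I_n -> X}) :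
  gact (tpow omega V n) g (basis_tensor v x) =
  lambdaXn v g x *: basis_tensor v (Gact g x).
Proof.
elim: n x => [|n IHn] x.
  by rewrite /= id_lfunE /lambdaXn !big_ord0 mulr1 scale1r.
rewrite basis_tensorS; have := @gact_tens _ _ omega (tpow omega V n) V g _ _ _ _
  (@graded_tpow n) graded_myd
  (basis_tensor_homog (ffinit x)) (basis_homog (x ord_max)).
move=> ->; rewrite IHn (lambdaXP hv) tensZl tensZr !scalerA.
rewrite basis_tensorS Gact_init ffunE lambdaXnS prefix_deg_init //.
congr (_ *: _); ring.
Qed.

Lemma lambdaXnM n g h (x : {ffun 'I_n -> X}) :
  lambdaXn v (g * h)%g x = omega2 omega g h (prefix_deg x n)
    * (lambdaXn v g (Gact h x) * lambdaXn v h x).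
Proof.
elim: n x => [|n IHn] x.
  by rewrite /lambdaXn !big_ord0 prefix_deg0 omega2_1 !mulr1.
rewrite 3!lambdaXnS IHn ffunE (lambdaXM hv) prefix_deg_Gact (myd_deg_perm hv).
rewrite prefix_degS Gact_init prefix_deg_init //.
set a := prefix_deg x n; set b := myd_deg _.
have e := omega1_omega2 omega g h a b.
set l1 := lambdaXn _ _ _; set l2 := lambdaXn _ _ _.
set l3 := lambdaX _ _ _; set l4 := lambdaX _ _ _.
transitivity (l1 * l2 * l3 * l4 *
  (omega1 omega (g * h)%g a b * omega2 omega g h a * omega2 omega g h b)).
  by ring.
by rewrite e; ring.
Qed.

Lemma GactM n g h (x : {ffun 'I_n -> X}) : Gact (g * h)%g x = Gact g (Gact h x).
Proof. by apply/ffunP => j; rewrite !ffunE (myd_permM hv). Qed.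

Lemma Gact1 n (x : {ffun 'I_n -> X}) : Gact 1%g x = x.
Proof. by apply/ffunP => j; rewrite !ffunE (myd_perm1 hv). Qed.

Lemma tline_vline n (L : 'I_n -> {vspace V}) (u : 'I_n -> V) :
  (forall j, L j = <[u j]>%VS) -> tline omega L = <[tvec omega u]>%VS.
Proof.
elim: n L u => [|n IHn] L u Lu /=.
  apply/vspaceP => w; rewrite memvf; apply/esym/vlineP.
  by exists w; rewrite [_ *: _]mulr1.
by rewrite Lu (IHn _ (fun i => u (widen_ord (leqnSn n) i))) ?tensv_line.
Qed.

(** The line of x is spanned by basis_tensor v x, on which a stabilizing g acts
    by the scalar lambdaXn v g x. *)
Lemma is_regularP n (x : {ffun 'I_n -> X}) :
  reflect (forall g, Gact g x = x -> lambdaXn v g x = 1) (is_regular x).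
Proof.
have lE : tline omega (fun j => myd_line (x j)) = <[basis_tensor v x]>%VS.
  by apply: tline_vline => j; apply: myd_lineE.
have fixE g : Gact g x = x ->
    (<[basis_tensor v x]> <= fixedSpace (gact (tpow omega V n) g))%VS
      = (lambdaXn v g x == 1).
  have [d gb] := graded_basis_tpow n.
  move=> gx; rewrite -memvE; apply/fixedSpaceP/eqP => [|l1]; last first.
    by rewrite gact_basis_tensor gx l1 scale1r.
  rewrite gact_basis_tensor gx => /(congr1 (d x)); rewrite linearZ /=.
  by rewrite (dual_delta (graded_dual gb)) eqxx [_ *: _]mulr1.
apply: (iffP forallP) => [H g gx|H g]; last first.
  by apply/implyP => /eqP gx; rewrite lE fixE // H.
by have := H g; rewrite gx eqxx lE fixE // => /eqP.
Qed.

End Powers.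

(** * Braiding of tuples and its scalars *)

Lemma ord_ltn_neq n (p q : 'I_n) :
  (p < q)%N -> ((p == q) = false) * ((q == p) = false).
Proof. by move=> pq; rewrite -!val_eqE /= ltn_eqF ?gtn_eqF. Qed.

Section BraidOnWords.
Variables (K : fieldType) (gT : finGroupType) (omega : cocycle3 K gT).
Variable V : monomialYD omega.
Let X := myd_index V.
Variable v : X -> V.
Hypothesis hv : forall x, v x \in myd_line x /\ v x != 0.
Implicit Types (g h : gT).

Lemma strand12_neq n (i : 'I_n.-1) : (strand1 i == strand2 i) = false.
Proof. by rewrite -val_eqE /= ltn_eqF. Qed.

Lemma sigmaX_inj n (i : 'I_n.-1) : injective (@sigmaX _ _ _ V n i).
Proof.
move=> x y /ffunP xy.
have e1 : x (strand1 i) = y (strand1 i).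
  by have := xy (strand2 i); rewrite !ffunE eq_sym strand12_neq eqxx.
have e2 : x (strand2 i) = y (strand2 i).
  by have := xy (strand1 i); rewrite !ffunE eqxx e1 => /perm_inj.
apply/ffunP => j; have := xy j; rewrite !ffunE.
by case: eqP => [->//|_]; case: eqP => [->|].
Qed.

Lemma sigmaX_far n (i j : 'I_n.-1) : (i.+1 < j)%N ->
  forall x, @sigmaX _ _ _ V n i (sigmaX j x) = sigmaX j (sigmaX i x).
Proof.
move=> ij x.
have e11 := @ord_ltn_neq n (strand1 i) (strand1 j) (ltnW ij).
have e12 := @ord_ltn_neq n (strand1 i) (strand2 j) (leqW (ltnW ij)).
have e21 := @ord_ltn_neq n (strand2 i) (strand1 j) ij.
have e22 := @ord_ltn_neq n (strand2 i) (strand2 j) (leqW ij).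
apply/ffunP => k; rewrite !ffunE !(e11, e12, e21, e22).
have [->|k1] := eqVneq k (strand1 i); first by rewrite !(e11, e12).
have [->|k2] := eqVneq k (strand2 i); first by rewrite !(e21, e22).
by [].
Qed.

(** Writing a, b, c for the three letters and A, B for the degrees of the first
    two, both sides give (A |> (B |> c), A |> b, a); the first entries agree
    because A |> b has degree A B A^-1. *)
Lemma sigmaX_near n (i j : 'I_n.-1) : i.+1 = j :> nat ->
  forall x, @sigmaX _ _ _ V n i (sigmaX j (sigmaX i x))
            = sigmaX j (sigmaX i (sigmaX j x)).
Proof.
move=> ij x.
have ji : strand1 j = strand2 i by apply: ord_inj; rewrite /= ij.
have e12 := ord_ltn_neq (ltnSn i : (strand1 i < strand2 i)%N).
have e13 : ((strand1 i == strand2 j) = false) * ((strand2 j == strand1 i) = false).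
  by apply: ord_ltn_neq; rewrite /= -ij ltnW.
have e23 : ((strand2 i == strand2 j) = false) * ((strand2 j == strand2 i) = false).
  by rewrite -ji; apply: ord_ltn_neq.
apply/ffunP => k; rewrite !ffunE !ji ?(e12, e13, e23, eqxx).
have [->|k1] := eqVneq k (strand1 i).
  rewrite ?(e12, e13, e23, eqxx).
  by rewrite (myd_deg_perm hv) -!(myd_permM hv) lconjE.
by case: (eqVneq k (strand2 i)) => // _; case: eqVneq.
Qed.

Lemma sigmaX_Gact n (i : 'I_n.-1) g (x : {ffun 'I_n -> X}) :
  sigmaX i (Gact g x) = Gact g (sigmaX i x).
Proof.
apply/ffunP => j; rewrite !ffunE.
case: ifP => _; last by case: ifP.
by rewrite (myd_deg_perm hv) -!(myd_permM hv) lconjE.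
Qed.

Lemma sigmaX_init n (i : 'I_n) (i' : 'I_n.-1) (x : {ffun 'I_n.+1 -> X}) :
    i' = i :> nat ->
  ffinit (sigmaX (i : 'I_n.+1.-1) x) = sigmaX i' (ffinit x)
  /\ sigmaX (i : 'I_n.+1.-1) x ord_max = x ord_max.
Proof.
move=> ii'; split; last first.
  have := (strand_subproof i').2; rewrite ii' => lti.
  by rewrite ffunE -!val_eqE /= (gtn_eqF lti) gtn_eqF.
have s1 : widen_ord (leqnSn n) (strand1 i') = strand1 (n := n.+1) i.
  by apply: ord_inj.
have s2 : widen_ord (leqnSn n) (strand2 i') = strand2 (n := n.+1) i.
  by apply: ord_inj; rewrite /= ii'.
by apply/ffunP => j; rewrite !ffunE s1 s2 -!val_eqE /= ii'.
Qed.

Lemma sigmaX_last n (x : {ffun 'I_n.+2 -> X}) :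
  let y := sigmaX (ord_max : 'I_n.+2.-1) x in
  let a := ffinit x ord_max in
  [/\ ffinit (ffinit y) = ffinit (ffinit x),
      ffinit y ord_max = myd_perm V (myd_deg a) (x ord_max)
    & y ord_max = a].
Proof.
have s1 : widen_ord (leqnSn n.+1) ord_max = strand1 (n := n.+2) ord_max.
  by apply: ord_inj.
have s2 : ord_max = strand2 (n := n.+2) ord_max by apply: ord_inj.
split.
- by apply/ffunP => j; rewrite !ffunE -!val_eqE /= !ltn_eqF // ltnS ltnW.
- by rewrite !ffunE s1 eqxx -s2.
- by rewrite !ffunE s1 {1}s2 eq_sym strand12_neq -s2 eqxx.
Qed.

(** Generators either act on the first n factors or cross the last two ones;
    both the powers of V and their braid operators are defined by recursion
    along this alternative. *)
Lemma generator_ind (P : forall n, 'I_n.-1 -> Prop) :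
    (forall n (i : 'I_n) (i' : 'I_n.-1),
       i' = i :> nat -> P n i' -> P n.+1 i) ->
    (forall n, P n.+2 ord_max) ->
  forall n i, P n i.
Proof.
move=> Pinit Plast; elim=> [|n IHn] i; first by case: i.
have [ltin|] := ltnP i n.-1; first exact: (Pinit n i (Ordinal ltin)).
case: n {IHn} i => [|n] i lei; first by case: i lei.
suff -> : i = ord_max by apply: Plast.
by apply/ord_inj/eqP; rewrite eqn_leq lei andbT -ltnS ltn_ord.
Qed.

Lemma prefix_deg_sigmaX n (i : 'I_n.-1) (x : {ffun 'I_n -> X}) :
  prefix_deg (sigmaX i x) n = prefix_deg x n.
Proof.
move: n i x; apply: generator_ind => [n i i' ii' IHi x|n x].
  have [e1 e2] := sigmaX_init x ii'.
  by rewrite !prefix_degS -!(@prefix_deg_init _ _ _ _ n _ n) // e1 e2 IHi.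
have [e0 e1 e2] := sigmaX_last x.
rewrite !prefix_degS -!(@prefix_deg_init _ _ _ _ n.+1 _ n.+1) //.
rewrite !prefix_degS e1 e2 -!(@prefix_deg_init _ _ _ _ n _ n) // e0.
by rewrite (myd_deg_perm hv) -mulgA lconjE mulgA.
Qed.

(** The factor of beta that does not involve g; it is the coefficient of
    basis_tensor v (sigmaX i x) in the image of basis_tensor v x under the
    i-th braid operator. *)
Definition sigma_coeff n (i : 'I_n.-1) (x : {ffun 'I_n -> X}) : K :=
  let p := prefix_deg x i in
  let x1 := x (strand1 i) in
  let x2 := x (strand2 i) in
  (omega p (myd_deg (myd_perm V (myd_deg x1) x2)) (myd_deg x1))^-1
  * lambdaX v (myd_deg x1) x2
  * omega p (myd_deg x1) (myd_deg x2).

Lemma sigma_coeff_neq0 n (i : 'I_n.-1) x : @sigma_coeff n i x != 0.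
Proof.
by rewrite !mulf_neq0 ?invr_neq0 ?cocycle_neq0 // lambdaX_neq0.
Qed.

Lemma sigma_coeff_init n (i : 'I_n) (i' : 'I_n.-1) (x : {ffun 'I_n.+1 -> X}) :
  i' = i :> nat -> sigma_coeff (i : 'I_n.+1.-1) x = sigma_coeff i' (ffinit x).
Proof.
move=> ii'; rewrite /sigma_coeff !ffunE.
have -> : widen_ord (leqnSn n) (strand1 i') = strand1 (n := n.+1) i.
  by apply: ord_inj.
have -> : widen_ord (leqnSn n) (strand2 i') = strand2 (n := n.+1) i.
  by apply: ord_inj; rewrite /= ii'.
by rewrite prefix_deg_init ii' // ltnW.
Qed.

Lemma sigma_coeff_last n (x : {ffun 'I_n.+2 -> X}) :
  let p := prefix_deg (ffinit (ffinit x)) n in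
  let a := ffinit x ord_max in
  let b := x ord_max in
  sigma_coeff (ord_max : 'I_n.+2.-1) x =
  (omega p (lconj (myd_deg a) (myd_deg b)) (myd_deg a))^-1
  * lambdaX v (myd_deg a) b * omega p (myd_deg a) (myd_deg b).
Proof.
rewrite /sigma_coeff !ffunE !prefix_deg_init // (myd_deg_perm hv).
have -> : widen_ord (leqnSn n.+1) ord_max = strand1 (n := n.+2) ord_max.
  by apply: ord_inj.
by have -> : ord_max = strand2 (n := n.+2) ord_max by apply: ord_inj.
Qed.

(** The equivariance of the braiding on v_a (x) v_b: the degree of g a times g
    is g times the degree of a, so both products of lambdaX describe the same
    action on v_b, up to the factors omega2 that omega1_braiding balances. *)
Lemma lambdaX_braiding g (a b : X) :
  omega1 omega g (myd_deg a) (myd_deg b)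
    * (lambdaX v (lconj g (myd_deg a)) (myd_perm V g b) * lambdaX v g b)
  = omega1 omega g (lconj (myd_deg a) (myd_deg b)) (myd_deg a)
    * (lambdaX v g (myd_perm V (myd_deg a) b) * lambdaX v (myd_deg a) b).
Proof.
apply: (mulfI (omega2_neq0 omega (lconj g (myd_deg a)) g (myd_deg b))).
rewrite mulrCA -(lambdaXM hv) lconjE (lambdaXM hv g (myd_deg a)).
rewrite mulrA -[RHS]mulrCA [RHS]mulrA -omega1_braiding.
by ring.
Qed.

(** The equivariance of the braid operators.  When the last two letters a, b
    are crossed, with U the degree of the preceding ones, the defect is
    measured by the associators of (U, A, B) and of (U, A B A^-1, A); both
    have product degree U A B, so their factors omega1 g U (A B) cancel and the
    braiding identity remains. *)
Lemma lambdaXn_sigmaX n (i : 'I_n.-1) g (x : {ffun 'I_n -> X}) :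
  sigma_coeff i (Gact g x) * lambdaXn v g x =
  lambdaXn v g (sigmaX i x) * sigma_coeff i x.
Proof.
move: n i x; apply: generator_ind => [n i i' ii' IHi x|n x].
  have [e1 e2] := sigmaX_init x ii'.
  rewrite !lambdaXnS !(sigma_coeff_init _ ii') Gact_init e1 e2.
  rewrite -!(@prefix_deg_init _ _ _ _ n _ n) // e1 prefix_deg_sigmaX.
  by rewrite 2!mulrA IHi; ring.
have [e0 e1 e2] := sigmaX_last x.
rewrite !sigma_coeff_last !lambdaXnS -!(@prefix_deg_init _ _ _ _ n.+1 _ n.+1) //.
rewrite !prefix_degS -!(@prefix_deg_init _ _ _ _ n _ n) // !Gact_init e0 e1 e2.
rewrite (prefix_deg_Gact hv) !(myd_deg_perm hv).
rewrite [Gact g x ord_max]ffunE [Gact g _ ord_max]ffunE !(myd_deg_perm hv).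
set b := x ord_max; set a := ffinit x ord_max; set u := ffinit (ffinit x).
set A := myd_deg a; set B := myd_deg b; set U := prefix_deg u n.
(* The two associators that surround the braiding. *)
have E1 := omega1_assoc omega g U A B.
have := omega1_assoc omega g U (lconj A B) A; rewrite lconjE -lconjM.
have -> : lconj (g * A) B = lconj (lconj g A) (lconj g B).
  by rewrite -lconjM lconjE.
have E3 := lambdaX_braiding g a b; rewrite -/A -/B in E3 *.
have W0 := cocycle_neq0 omega (lconj g U) (lconj (lconj g A) (lconj g B))
  (lconj g A).
have w0 := cocycle_neq0 omega U (lconj A B) A.
move: W0 w0 E1 E3.
move: (omega _ (lconj (lconj g A) _) _) (omega U (lconj A B) A) => W' w'.
set W := omega (lconj g U) _ _; set w := omega U A B.
set P := omega1 _ _ (U * A) B; set Q := omega1 _ _ U A.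
set P' := omega1 _ _ (U * lconj A B) A; set Q' := omega1 _ _ U (lconj A B).
set S := omega1 omega g A B; set S' := omega1 omega g (lconj A B) A.
set R := omega1 omega g U (A * B)%g; set l1 := lambdaX v (lconj g A) _.
set l2 := lambdaX v g b; set l3 := lambdaX v g _; set l4 := lambdaX v A b.
set La := lambdaX v g a; set Lu := lambdaXn v g u.
move=> W0 w0 E1 E3 E2.
transitivity (W'^-1 * l1 * l2 * Lu * La * (P * Q * W)); first by ring.
rewrite E1; transitivity (W'^-1 * Lu * La * w * R * (S * (l1 * l2))).
  by ring.
rewrite E3; transitivity (W'^-1 * Lu * La * w * l3 * l4 * w'^-1 * (w' * R * S')).
  by field; rewrite W0 w0.
by rewrite -E2; field; rewrite W0 w0.
Qed.

End BraidOnWords.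

(** * Braid operators *)

Section BraidOperators.
Variables (K : fieldType) (gT : finGroupType) (omega : cocycle3 K gT).
Variable V : monomialYD omega.
Let X := myd_index V.
Variable v : X -> V.
Hypothesis hv : forall x, v x \in myd_line x /\ v x != 0.
Implicit Types (g h : gT).

(** The inverse associator is evaluated without a formula for it: it suffices
    to exhibit a preimage, the associator being injective. *)
Lemma braid_last_basis n (x : {ffun 'I_n.+2 -> X}) :
  braid_last omega V n (basis_tensor v x) =
  sigma_coeff v (ord_max : 'I_n.+2.-1) x
    *: basis_tensor v (sigmaX (ord_max : 'I_n.+2.-1) x).
Proof.
have [e0 e1 e2] := sigmaX_last x.
rewrite !(basis_tensorS v) e0 e1 e2 (sigma_coeff_last hv).
set b := x ord_max; set a := ffinit x ord_max; set u := ffinit (ffinit x).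
have gV := graded_myd hv; have gP := @graded_tpow _ _ _ _ _ hv n.
have assocE y z := center_assoc_tens omega gP gV gV
  (basis_tensor_homog hv u) (basis_homog hv y) (basis_homog hv z).
have injA : lker (center_assoc omega (tpow omega V n) V V) == 0%VS.
  have [d gb] := graded_basis_tpow hv n; have gc := myd_graded_basis hv.
  exact: (center_assoc_inj omega gb gc gc).
rewrite /braid_last comp_lfunE comp_lfunE assocE linearZ /=.
rewrite tmap_tens id_lfunE (center_braiding_tens _ _ gV (basis_homog hv a)).
rewrite (lambdaXP hv) tensZl tensZr.
set e' := tens (tens _ (v (myd_perm V (myd_deg a) b))) (v a).
have -> : tens (basis_tensor v u : tpow omega V n)
    (tens (v (myd_perm V (myd_deg a) b)) (v a))
  = center_assoc omega (tpow omega V n) V V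
     ((omega (prefix_deg u n) (lconj (myd_deg a) (myd_deg b)) (myd_deg a))^-1 *: e').
  rewrite linearZ /= assocE (myd_deg_perm hv) scalerA mulVf ?scale1r //.
  exact: cocycle_neq0.
rewrite !linearZ /= lker0_lfunK // !scalerA.
by congr (_ *: _); ring.
Qed.

Lemma braid_op_basis n (i : 'I_n.-1) (x : {ffun 'I_n -> X}) :
  braid_op omega V n i (basis_tensor v x) =
  sigma_coeff v i x *: basis_tensor v (sigmaX i x).
Proof.
move: n i x; apply: generator_ind => [n i i' ii' IHi x|n x]; last first.
  by rewrite -braid_last_basis /= eqxx.
have [e1 e2] := sigmaX_init x ii'.
rewrite !(basis_tensorS v) e1 e2 (sigma_coeff_init v _ ii').
case: n i i' ii' IHi x e1 e2 => [|n] i i' ii' IHi x e1 e2.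
  by have := ltn_ord i.
have -> : braid_op omega V n.+2 i = tmap (braid_op omega V n.+1 i') \1%VF.
  by rewrite /= -ii' ltn_eqF.
by rewrite tmap_tens id_lfunE IHi tensZl.
Qed.

End BraidOperators.

(** * Invariants and averages *)

Lemma free_map_dual (K : fieldType) (W : vectType K) (I : eqType) (s : seq I)
    (f : I -> W) (c : I -> 'Hom(W, K^o)) :
    uniq s -> {in s, forall i, c i (f i) != 0} ->
    {in s &, forall i j, i != j -> c i (f j) = 0} ->
  free [seq f i | i <- s].
Proof.
elim: s => [|i s IHs] /=; first by rewrite nil_free.
case/andP => nis us nz z; rewrite free_cons IHs // ?andbT; last first.
- by move=> j k js ks; apply: z; rewrite inE (js, ks) orbT.
- by move=> j js; apply: nz; rewrite inE js orbT.
apply: contra (nz i (mem_head _ _)) => fi; rewrite -memv_ker.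
apply: subvP fi; apply/span_subvP => _ /mapP[j js ->]; rewrite memv_ker.
rewrite z ?mem_head ?inE ?js ?orbT //.
by apply: contraNneq nis => ->.
Qed.

Lemma memv_invariants (K : fieldType) (gT : finGroupType) (A : gspace K gT) u :
  u \in invariants A <-> u \in homog A 1%g /\ forall g, gact A g u = u.
Proof.
rewrite /invariants memv_cap; split=> [/andP[-> fu]|[-> fu]] /=.
  split=> // g; apply/fixedSpaceP; apply: subvP fu; exact: (bigcapv_inf g).
by rewrite memvE; apply/subv_bigcapP => g _; rewrite -memvE; apply/fixedSpaceP.
Qed.

Lemma center_unit_morphismP (K : fieldType) (gT : finGroupType)
    (A : gspace K gT) (f : 'Hom(center_unit K gT, A)) :
  is_center_morphism f <-> f 1 \in invariants A.
Proof.
rewrite memv_invariants; split=> [[fh fg]|[f1 fg]].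
  split=> [|g]; last by rewrite -fg /= id_lfunE.
  by apply: subvP (fh 1%g) _ _; rewrite memv_img //= eqxx memvf.
have fE (u : K^o) : f u = (u : K) *: f 1 by rewrite -linearZ /= [_ *: _]mulr1.
split=> [g|g u]; last by rewrite /= id_lfunE fE linearZ /= fg.
apply/subvP => _ /memv_imgP[u + ->].
rewrite -[homog (center_unit K gT) g]/(if g == 1%g then fullv else 0%VS).
have [->|_] := eqVneq g 1%g; first by rewrite fE memvZ.
by rewrite memv0 => /eqP ->; rewrite linear0 mem0v.
Qed.

Section Averages.
Variables (K : fieldType) (gT : finGroupType) (omega : cocycle3 K gT).
Hypothesis K0 : [pchar K] =i pred0.
Variable V : monomialYD omega.
Let X := myd_index V.
Variable v : X -> V.
Hypothesis hv : forall x, v x \in myd_line x /\ v x != 0.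
Variable n : nat.
Implicit Types (g h : gT) (x y : {ffun 'I_n -> X}).

Let w x : tpow omega V n := basis_tensor v x.

Lemma Av_linear : linear (@Av K gT (tpow omega V n)).
Proof.
move=> a u u'; rewrite /Av scalerA mulrC -scalerA -scalerDr; congr (_ *: _).
by rewrite scaler_sumr -big_split; apply: eq_bigr => g _; rewrite linearP.
Qed.

HB.instance Definition _ :=
  GRing.isLinear.Build K (tpow omega V n) (tpow omega V n) *:%R
    (@Av K gT (tpow omega V n)) Av_linear.

Lemma card_neq0 : #|gT|%:R != 0 :> K.
Proof. by rewrite (pcharf0P _).1 // -lt0n; apply/card_gt0P; exists 1%g. Qed.

Lemma Av_fixed (u : tpow omega V n) :
  (forall g, gact (tpow omega V n) g u = u) -> Av u = u.
Proof.
move=> fu; rewrite /Av (eq_bigr _ (fun g _ => fu g)) sumr_const.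
by rewrite -scaler_nat scalerA mulVf ?scale1r ?card_neq0.
Qed.

Lemma Av_basis x :
  Av (w x) = #|gT|%:R^-1 *: \sum_g lambdaXn v g x *: w (Gact g x).
Proof.
by rewrite /Av; congr (_ *: _); apply: eq_bigr => g _; apply: gact_basis_tensor.
Qed.

Lemma lambdaXnM1 g h x : x \in degree1 V n ->
  lambdaXn v (g * h)%g x = lambdaXn v g (Gact h x) * lambdaXn v h x.
Proof.
by rewrite inE => /eqP x1; rewrite (lambdaXnM hv) x1 omega2_1 mul1r.
Qed.

Lemma Gact_degree1 g x : x \in degree1 V n -> Gact g x \in degree1 V n.
Proof. by rewrite !inE (prefix_deg_Gact hv) => /eqP ->; rewrite lconj1. Qed.

(** Translating the summation variable of Av absorbs g, because lambdaXn is
    multiplicative in degree 1. *)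
Lemma Av_Gact g x : x \in degree1 V n ->
  lambdaXn v g x *: Av (w (Gact g x)) = Av (w x).
Proof.
move=> x1; rewrite !Av_basis scalerA mulrC -scalerA; congr (_ *: _).
rewrite scaler_sumr [RHS](reindex_inj (mulIg g)); apply: eq_bigr => h _.
by rewrite scalerA (GactM hv) lambdaXnM1 // mulrC.
Qed.

Lemma gact_Av g x : x \in degree1 V n ->
  gact (tpow omega V n) g (Av (w x)) = Av (w x).
Proof.
move=> x1; rewrite Av_basis linearZ linear_sum; congr (_ *: _).
rewrite [RHS](reindex_inj (mulgI g)); apply: eq_bigr => h _.
rewrite linearZ /= (gact_basis_tensor hv) scalerA (GactM hv) lambdaXnM1 //.
by rewrite mulrC.
Qed.

Lemma Av_invariant x : x \in degree1 V n -> Av (w x) \in invariants (tpow omega V n).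
Proof.
move=> x1; apply/memv_invariants; split=> [|g]; last exact: gact_Av.
rewrite Av_basis memvZ // memv_suml // => g _; rewrite memvZ //.
have := Gact_degree1 g x1; rewrite inE => /eqP <-; exact: basis_tensor_homog.
Qed.

(** For g fixing x, Av (w x) = lambdaXn v g x *: Av (w x). *)
Lemma Av_irregular x : x \in degree1 V n -> x \notin regulars V n -> Av (w x) = 0.
Proof.
move=> x1; rewrite inE x1 /= => /(is_regularP hv) irr; apply: contra_notP irr.
move=> /eqP Av0 g gx; have := Av_Gact g x1; rewrite gx.
rewrite -[RHS]scale1r => /eqP; rewrite -subr_eq0 -scalerBl scaler_eq0 subr_eq0.
by rewrite (negbTE Av0) orbF => /eqP.
Qed.

Lemma coord_Av_orbit d deg x y : graded_basis w d deg ->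
  y \notin Gorbit x -> d y (Av (w x)) = 0.
Proof.
move=> gb ynx; rewrite Av_basis linearZ linear_sum /= big1 ?scaler0 // => g _.
rewrite linearZ /= (dual_delta (graded_dual gb)).
by case: eqP ynx => [-> /negP[]|]; [apply: imset_f | rewrite scaler0].
Qed.

(** The coordinate is |Stab x| / |G|: every g fixing x contributes 1. *)
Lemma coord_Av_regular d deg x : graded_basis w d deg ->
  x \in regulars V n -> d x (Av (w x)) != 0.
Proof.
move=> gb; rewrite inE => /andP[_ /(is_regularP hv) reg].
rewrite Av_basis linearZ linear_sum /=.
have -> : \sum_g d x (lambdaXn v g x *: w (Gact g x)) =
    #|[set g | Gact g x == x]|%:R :> K^o.
  rewrite -sum1_card natr_sum [RHS]big_mkcond; apply: eq_bigr => g _.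
  rewrite linearZ /= (dual_delta (graded_dual gb)) inE eq_sym.
  by case: eqP => [/reg ->|_]; rewrite ?scaler0 // scale1r.
rewrite scaler_eq0 invr_eq0 negb_or card_neq0 (pcharf0P _).1 // -lt0n.
by apply/card_gt0P; exists 1%g; rewrite inE (Gact1 hv).
Qed.

Lemma Gorbit_refl x : x \in Gorbit x.
Proof. by apply/imsetP; exists 1%g; rewrite ?(Gact1 hv). Qed.

Lemma GactK g : cancel (Gact (V := V) (n := n) g) (Gact g^-1%g).
Proof. by move=> x; rewrite -(GactM hv) mulVg (Gact1 hv). Qed.

Lemma Gorbit_Gact g x : Gorbit (Gact g x) = Gorbit x.
Proof.
apply/setP => y; apply/imsetP/imsetP => -[h _ ->].
  by exists (h * g)%g; rewrite ?(GactM hv).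
by exists (h * g^-1)%g; rewrite // (GactM hv) GactK.
Qed.

(** On tuples of degree 1, regularity is equivalent to Av (w x) != 0, which is
    visibly invariant along orbits by Av_Gact. *)
Lemma is_regular_Gact g x : x \in regulars V n -> Gact g x \in regulars V n.
Proof.
move=> xr; have := xr; rewrite inE => /andP[x1 _]; apply/negPn/negP => irr.
have := Av_Gact g x1; rewrite (Av_irregular (Gact_degree1 g x1) irr) scaler0.
have [d gb] := graded_basis_tpow hv n; have := coord_Av_regular gb xr.
by move=> /[swap] <-; rewrite linear0 eqxx.
Qed.

Section Representatives.
Variable Rep : {set {ffun 'I_n -> X}}.
Hypothesis hRep : is_orbit_reps Rep.

Lemma rep_regular x : x \in Rep -> x \in regulars V n.
Proof. exact/subsetP/(hRep.1). Qed.

Lemma rep_degree1 x : x \in Rep -> x \in degree1 V n.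
Proof. by move/rep_regular; rewrite inE => /andP[]. Qed.

Lemma rep_uniq y x z : y \in regulars V n ->
  x \in Rep :&: Gorbit y -> z \in Rep :&: Gorbit y -> x = z.
Proof.
move=> /(hRep.2)/eqP/cards1P[t ->]; by rewrite !inE => /eqP -> /eqP ->.
Qed.

Lemma orbit_proj_mem y : y \in regulars V n -> orbit_proj Rep y \in Rep :&: Gorbit y.
Proof.
move=> yr; rewrite /orbit_proj; case: pickP => //= none.
by have := hRep.2 y yr; rewrite (eq_card0 none).
Qed.

Lemma orbit_proj_Rep x : x \in Rep -> orbit_proj Rep x = x.
Proof.
move=> xR; have xr := rep_regular xR.
by apply: (rep_uniq xr (orbit_proj_mem xr)); rewrite inE xR Gorbit_refl.
Qed.

Lemma orbit_proj_Gact g y : y \in regulars V n ->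
  orbit_proj Rep (Gact g y) = orbit_proj Rep y.
Proof.
move=> yr; apply: (rep_uniq yr _ (orbit_proj_mem yr)).
rewrite -(Gorbit_Gact g); exact/orbit_proj_mem/is_regular_Gact.
Qed.

(** Averages over distinct orbits have disjoint supports, hence independence.
    An invariant u equals Av u, so it is a combination of averages of basis
    tensors, each of them 0 or proportional to the average at a
    representative. *)
Lemma Av_basis_of :
  basis_of (invariants (tpow omega V n)) [seq Av (w x) | x <- enum Rep].
Proof.
have [d gb] := graded_basis_tpow hv n.
apply/andP; split; last first.
  apply: (free_map_dual (c := d)); first exact: enum_uniq.
    by move=> x; rewrite mem_enum => /rep_regular; apply: coord_Av_regular gb.
  move=> x y; rewrite !mem_enum => xR yR neq; apply: coord_Av_orbit gb _.
  apply: contra neq => xy; apply/eqP; apply: (rep_uniq (rep_regular yR)).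
    by rewrite inE xR.
  by rewrite inE yR Gorbit_refl.
rewrite eqEsubv; apply/andP; split.
  apply/span_subvP => _ /mapP[x xR ->]; apply/Av_invariant/rep_degree1.
  by rewrite mem_enum in xR.
apply/subvP => u /memv_invariants[u1 fu]; rewrite -(Av_fixed fu).
rewrite (dual_expand (graded_dual gb) u) linear_sum memv_suml // => x _.
rewrite linearZ /=; have [->|nz] := eqVneq (d x u) 0.
  by rewrite scale0r mem0v.
have x1 : x \in degree1 V n by rewrite inE ((graded_homog gb _ _).1 u1 _ nz).
rewrite memvZ //; have [xr|/(Av_irregular x1) ->] := boolP (x \in regulars V n);
  last exact: mem0v.
have := orbit_proj_mem xr; rewrite inE => /andP[yR /imsetP[g _ yE]].
rewrite -(Av_Gact g x1) -yE memvZ // memv_span //.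
by apply/mapP; exists (orbit_proj Rep x); rewrite ?mem_enum.
Qed.

End Representatives.

Lemma sigmaX_degree1 (i : 'I_n.-1) x :
  x \in degree1 V n -> sigmaX i x \in degree1 V n.
Proof. by rewrite !inE (prefix_deg_sigmaX hv). Qed.

(** If g fixes sigmaX i x then it fixes x, and the equivariance identity
    equates the scalars of g at the two tuples. *)
Lemma sigmaX_regular (i : 'I_n.-1) x :
  x \in regulars V n -> sigmaX i x \in regulars V n.
Proof.
rewrite inE => /andP[x1 /(is_regularP hv) reg].
rewrite inE sigmaX_degree1 //=; apply/(is_regularP hv) => g.
rewrite -(sigmaX_Gact hv) => /sigmaX_inj gx.
apply: (mulIf (sigma_coeff_neq0 hv i x)).
by rewrite -(lambdaXn_sigmaX hv) gx reg // mulr1 mul1r.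
Qed.

(** The equivariance identity moves the braid operator inside the average, and
    Av_Gact replaces sigmaX i x by its translate under g. *)
Lemma braid_op_Av (i : 'I_n.-1) g x : x \in degree1 V n ->
  braid_op omega V n i (Av (w x)) =
  beta v i x g *: Av (w (Gact g (sigmaX i x))).
Proof.
move=> x1; rewrite -[beta v i x g]/(sigma_coeff v i x * lambdaXn v g (sigmaX i x)).
rewrite -scalerA Av_Gact ?sigmaX_degree1 // !Av_basis linearZ linear_sum.
rewrite scalerA mulrC -scalerA scaler_sumr; congr (_ *: _).
apply: eq_bigr => h _; rewrite linearZ /= (braid_op_basis hv) !scalerA.
by rewrite (sigmaX_Gact hv) mulrC (lambdaXn_sigmaX hv) mulrC.
Qed.

End Averages.

Local Open Scope complex_scope.

Theorem theorem3p4 (R : realType) (gT : finGroupType) (omega : cocycle3 R[i] gT)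
    (V : monomialYD omega) (v : myd_index V -> V)
    (hv : forall x, v x \in myd_line x /\ v x != 0)
    (n : nat) (Rep : {set {ffun 'I_n -> myd_index V}})
    (hRep : is_orbit_reps Rep) :
  exists aX aR : braid n -> {ffun 'I_n -> myd_index V} -> {ffun 'I_n -> myd_index V},
    (* (a) *)
    [/\ braid_action [set: {ffun 'I_n -> myd_index V}] aX
          /\ (forall i x, aX (braid_gen i) x = sigmaX i x),
        braid_action (regulars V n) aX,
        braid_action Rep aR,
        {in regulars V n, forall y, orbit_proj Rep y \in Rep :&: Gorbit y}
      & {in regulars V n, forall y b,
          orbit_proj Rep (aX b y) = aR b (orbit_proj Rep y)}]
    /\
    (* (b) *)
    [/\ forall f : 'Hom(center_unit R[i] gT, tpow omega V n),
          is_center_morphism f <-> f 1 \in invariants (tpow omega V n),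
        basis_of (invariants (tpow omega V n))
          [seq Av (basis_tensor v x) | x <- enum Rep]
      & {in Rep, forall x (i : 'I_n.-1),
          (exists g, Gact g (sigmaX i x) \in Rep) /\
          (forall g, Gact g (sigmaX i x) \in Rep ->
             braid_op omega V n i (Av (basis_tensor v x)) =
             beta v i x g *: Av (basis_tensor v (aR (braid_gen i) x)))}].
Proof.
have K0 : [pchar R[i]] =i pred0 by apply: Num.Theory.pchar_num.
pose aX := braid_act (@sigmaX _ _ _ V n).
pose aR b x := orbit_proj Rep (aX b x).
have inj := @sigmaX_inj _ _ _ V n.
have aX1 x : aX 1%g x = x.
  exact: (braid_act1 inj (@sigmaX_far _ _ _ V n) (sigmaX_near hv (n := n))).
have aXM b c x : aX (b * c)%g x = aX b (aX c x).
  exact: (braid_actM inj (@sigmaX_far _ _ _ V n) (sigmaX_near hv (n := n))).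
have aX_gen i x : aX (braid_gen i) x = sigmaX i x.
  exact: (braid_act_gen inj (@sigmaX_far _ _ _ V n) (sigmaX_near hv (n := n))).
have aX_reg b x : x \in regulars V n -> aX b x \in regulars V n.
  by apply: braid_act_closed => i y; apply: (sigmaX_regular hv).
have aX_Gact b g x : aX b (Gact g x) = Gact g (aX b x).
  by apply: (braid_act_comm inj) => i y; apply: (sigmaX_Gact hv).
have projP y : y \in regulars V n -> orbit_proj Rep y \in Rep :&: Gorbit y.
  exact: orbit_proj_mem hRep y.
have aR_proj b y : y \in regulars V n ->
    orbit_proj Rep (aX b y) = aR b (orbit_proj Rep y).
  move=> yr; rewrite /aR.
  have /setIP[_ /imsetP[g _ ->]] := projP y yr.
  by rewrite aX_Gact (orbit_proj_Gact K0 hv hRep) // aX_reg.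
have Rreg x : x \in Rep -> x \in regulars V n by apply: rep_regular.
exists aX, aR; split; split=> //.
- by split=> //; split.
- by split=> // x xr b; apply: aX_reg.
- split=> [x /Rreg xr b|x xR|x /Rreg xr b c].
  + by have /setIP[] := projP _ (aX_reg b x xr).
  + by rewrite /aR aX1 (orbit_proj_Rep hv hRep).
  + by rewrite -[aR c x]/(orbit_proj _ _) -aR_proj ?aX_reg // /aR aXM.
- by move=> y yr b; apply: aR_proj.
- by move=> f; apply: center_unit_morphismP.
- exact: Av_basis_of.
move=> x xR i; have xr := Rreg x xR.
have sr := sigmaX_regular hv i xr.
have /setIP[pR /imsetP[g0 _ pE]] := projP _ sr.
split=> [|g gR]; first by exists g0; rewrite -pE.
rewrite (braid_op_Av hv i g (rep_degree1 hRep xR)) /aR aX_gen.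
by rewrite -(orbit_proj_Gact K0 hv hRep g sr) (orbit_proj_Rep hv hRep).
Qed.
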